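(* Let $d\in\mathbb{N}$ and let $\omega$ be an admissible radial measure on $\mathbb{B}_d$ of the form $$d\omega(\zeta)=u(r)\,2r\,dr\,d\sigma(z),\qquad \zeta=rz,$$ for some $u\in L^\infty[0,1]$. Let $p$ be a polynomial in $d$ variables without zeros in $\mathbb{B}_d$, and let $n$ be an integer with $n\ge\deg p$ (total degree). Then $$F(z)=\log\Bigl(1+\log\frac{2^np(0)}{p(z)}\Bigr)\in B^1_\omega .$$
   Context: $\mathbb{B}_d$ is the open unit ball of $\mathbb{C}^d$, and $\sigma$ is the normalized rotation-invariant measure on $\partial\mathbb{B}_d$. An admissible radial measure is a measure of the form $d\omega(\zeta)=d\mu(r)\,d\sigma(z)$, $\zeta=rz$, $r\in[0,1]$, $z\in\partial\mathbb{B}_d$, where $\mu$ is a positive Borel measure on $[0,1]$ with $\mu((r,1])>0$ for every $0<r<1$; here $d\mu(r)=u(r)2r\,dr$ (so $u\ge 0$ a.e.). With $R=\sum_{j=1}^d z_j\frac{\partial}{\partial z_j}$, $B^1_\omega=\{f\in\mathrm{Hol}(\mathbb{B}_d):Rf\in L^2(\omega)\}$, where $\mathrm{Hol}(\mathbb{B}_d)$ is the set of analytic functions on $\mathbb{B}_d$. For such $p$ one has $|p(z)|\le 2^n|p(0)|$ on $\mathbb{B}_d$. The inner logarithm is any analytic branch on $\mathbb{B}_d$ (so it has nonnegative real part), and the outer logarithm is the principal branch. *)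

(* Defs.v *)
From HB Require Import structures.
From mathcomp Require Import all_boot all_order all_algebra.
From mathcomp Require Import all_classical all_reals all_analysis.
From mathcomp Require Import complex spectral.
From mathcomp Require mpoly.
Import -(notations) mpoly.

Set Implicit Arguments.
Unset Strict Implicit.
Unset Printing Implicit Defensive.

Import Order.TTheory GRing.Theory Num.Theory.
Import numFieldNormedType.Exports.

Local Open Scope classical_set_scope.
Local Open Scope ring_scope.
Local Open Scope complex_scope.

(* The instances that numFieldNormedType gives to an abstract numFieldType,
   for the concrete field R[i]; in particular, [differentiable] and ['D_v]
   below are complex (Fréchet, resp. directional) derivatives. *)
HB.instance Definition _ (R : realType) := GRing.ComAlgebra.copy R[i] R[i]^o.
HB.instance Definition _ (R : realType) := Vector.copy R[i] R[i]^o.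
HB.instance Definition _ (R : realType) := NormedModule.copy R[i] R[i]^o.

(* C^d with its Borel sigma-algebra. *)
Notation borelC R d := (g_sigma_algebraType (@open 'rV[R[i]%C]_d)).

Section Ball.
Variables (R : realType) (d : nat).
Implicit Types (z : 'rV[R[i]]_d) (f g L : 'rV[R[i]]_d -> R[i]).

(* Squared Euclidean norm; the library norm on 'rV_d is the sup norm. *)
Definition sqnormC z : R := \sum_(j < d) Normc.normc (z 0 j) ^+ 2.

Definition unit_ball : set 'rV[R[i]]_d := [set z | sqnormC z < 1].
Definition unit_sphere : set 'rV[R[i]]_d := [set z | sqnormC z = 1].

Definition Hol f : Prop := forall z, unit_ball z -> differentiable f z.

Definition radial_deriv f z : R[i] :=
  \sum_(j < d) z 0 j * 'D_(delta_mx 0 j) f z.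

(* Uniqueness of such a sigma follows from the transitivity of U(d) on the
   sphere, so this is the same measure as the O(2d)-invariant one. *)
Definition is_normalized_rotation_invariant (sigma : probability (borelC R d) R)
    : Prop :=
  sigma unit_sphere = 1%E /\
  forall U : 'M[R[i]]_d, U \is unitarymx ->
  forall A : set (borelC R d), measurable A ->
    sigma ((fun z : 'rV[R[i]]_d => z *m U) @^-1` A) = sigma A.

(* omega is the image of mu \x sigma under (r, z) |-> r z. *)
Definition is_admissible_radial (sigma : probability (borelC R d) R)
    (mu : {measure set (measurableTypeR R) -> \bar R})
    (omega : {measure set (borelC R d) -> \bar R}) : Prop :=
  [/\ mu (~` `[0, 1]%classic) = 0%E,
      forall r : R, 0 < r < 1 -> (0 < mu `]r, 1%R]%classic)%E
    & forall A : set (borelC R d), measurable A ->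
        omega A =
        (mu \x sigma)%E [set x : measurableTypeR R * borelC R d |
          A ((x.1 : R)%:C *: (x.2 : 'rV[R[i]]_d))]].

(* The integral is over the open ball, where f lives; the sphere is omega-null
   as soon as mu has no atom at 1. *)
Definition L2_ball (omega : {measure set (borelC R d) -> \bar R}) f : Prop :=
  [/\ measurable_fun (unit_ball : set (borelC R d)) (fun z => complex.Re (f z) : R),
      measurable_fun (unit_ball : set (borelC R d)) (fun z => complex.Im (f z) : R)
    & (\int[omega]_(z in unit_ball) (Normc.normc (f z) ^+ 2)%:E < +oo)%E].

Definition B1 (omega : {measure set (borelC R d) -> \bar R}) f : Prop :=
  Hol f /\ L2_ball omega (radial_deriv f).

Definition cpoly_eval (p : mpoly.mpoly d R[i]) z : R[i] :=
  mpoly.meval (fun j => z 0 j) p.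

Definition total_degree (p : mpoly.mpoly d R[i]) : nat := (mpoly.msize p).-1.

End Ball.

Section Density.
Variable R : realType.

Definition Linfty01 (u : R -> R) : Prop :=
  measurable_fun (`[0, 1]%classic : set (measurableTypeR R)) u /\
  exists M : R, {ae @lebesgue_measure R, forall r, `[0, 1]%classic r -> `|u r| <= M}.

(* d mu(r) = u(r) 2r dr on [0, 1] *)
Definition has_radial_density (u : R -> R)
    (mu : {measure set (measurableTypeR R) -> \bar R}) : Prop :=
  forall A : set (measurableTypeR R), measurable A ->
    mu A = (\int[@lebesgue_measure R]_(r in A `&` `[0%R, 1%R])
              (u r * (2 * r))%:E)%E.

End Density.

Section ComplexLog.
Variable R : realType.

Definition cexp (w : R[i]) : R[i] :=
  (expR (complex.Re w) * cos (complex.Im w)) +i* (expR (complex.Re w) * sin (complex.Im w)).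

(* Argument in ]-pi, pi]. *)
Definition principal_arg (w : R[i]) : R :=
  let t := acos (complex.Re w / Normc.normc w) in if 0 <= complex.Im w then t else - t.

Definition principal_log (w : R[i]) : R[i] :=
  ln (Normc.normc w) +i* principal_arg w.

Definition is_analytic_log (d : nat) (g L : 'rV[R[i]]_d -> R[i]) : Prop :=
  Hol L /\ forall z, unit_ball z -> cexp (L z) = g z.

End ComplexLog.

(* Main.v *)
Require Import Defs.
From HB Require Import structures.
From mathcomp Require Import all_boot all_order all_algebra.
From mathcomp Require Import all_classical all_reals all_analysis.
From mathcomp Require Import measurable_realfun complex spectral.
From mathcomp Require Import ring lra.
From mathcomp Require mpoly.
Import -(notations) mpoly.
Import Order.TTheory GRing.Theory Num.Theory.
Import numFieldNormedType.Exports.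
Local Open Scope classical_set_scope.
Local Open Scope ring_scope.
Local Open Scope complex_scope.

Set Implicit Arguments.
Unset Strict Implicit.
Unset Printing Implicit Defensive.

(* On the ball, [R F = - R p / (p (1 + L))] and
   [|1 + L| >= 1 + ln (2 ^ n |p 0| / |p|)]. Restricted to the complex line
   through a point [z] of the sphere, [p] becomes a univariate polynomial of
   degree at most [n] whose roots [b] satisfy [|b| >= 1]; then [R p / p] is
   bounded by the sum of the [|l| / |l - b|], while [2 ^ n |p 0| / |p (l z)|] is
   at least [2 |b| / |l - b|] for each root. So [|R F (l z)| ^ 2] is controlled
   by the functions [1 / (x (1 + ln (2 |b| / x))) ^ 2], [x = |l - b|], which are
   integrable on the disc, uniformly in [b].

   The two-dimensional integral is computed without a change of variables:
   [sigma] is invariant under unimodular scalars, so one may average over the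
   arc [t |-> sqrt (1 - t ^ 2) + i t], [0 <= t <= 1], along which the imaginary
   part of [l = r (sqrt (1 - t ^ 2) + i t)] is affine in [t]. Bounding
   [|l - b|] below by the mean of [1 - r] and [|r t - Im b|] leaves two
   one-dimensional integrals, with explicit primitives, up to constants,
   [1 / (y (4 - ln y) ^ 2)] and [1 / (4 - ln y)]. *)

(** * Elementary inequalities for [x (1 + ln (B / x))] *)

Section RealEstimates.
Variable R : realType.
Implicit Types x y b : R.

(** The function [x (1 + ln (B / x))] has derivative [ln (B / x)], nonnegative up to [B]. The proof
    uses no calculus: [ln (B / y) = ln (B / x) + ln (x / y)] and [y ln (x / y) <= x - y]. *)
Lemma le_mul_onep_ln (B x y : R) : 0 < y -> y <= x -> x <= B ->
  y * (1 + ln (B / y)) <= x * (1 + ln (B / x)).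
Proof.
move=> y0 yx xB; have x0 : 0 < x by exact: lt_le_trans yx.
have B0 : 0 < B by exact: lt_le_trans xB.
have lnBx : 0 <= ln (B / x) by rewrite ln_ge0// ler_pdivlMr// mul1r.
have lnxy : ln (x / y) <= x / y - 1.
  have := @le_ln1Dx _ (x / y - 1).
  rewrite [1 + _]addrC subrK; apply.
  by rewrite ltrBrDr addNr divr_gt0.
have -> : ln (B / y) = ln (B / x) + ln (x / y).
  by rewrite -lnM ?posrE ?divr_gt0// mulrA divfK// gt_eqF.
have yxy : y * (x / y) = x by rewrite mulrCA divff ?mulr1// gt_eqF.
have : y * ln (x / y) <= x - y.
  by apply: (le_trans (ler_wpM2l (ltW y0) lnxy)); rewrite mulrBr yxy mulr1.
have : y * ln (B / x) <= x * ln (B / x) by exact: ler_wpM2r.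
nra.
Qed.

(** This removes [b] from the bound: by monotonicity the right-hand side is at least
    [4 y (1 + ln (2 b) - ln y)], where [ln (2 b)] and [- ln y] are nonnegative. *)
Lemma le_mul_four_subr_ln (b x y : R) : 0 < y -> y <= 1 -> y <= x ->
  1 <= b -> x <= 2 * b ->
  y * (4 - ln y) <= 4 * (x * (1 + ln (2 * b / x))).
Proof.
move=> y0 y1 yx b1 xb.
have := le_mul_onep_ln y0 yx xb.
have b0 : 0 < 2 * b by lra.
rewrite ln_div ?posrE//.
have : 0 <= ln (2 * b) by rewrite ln_ge0//; lra.
have : ln y <= 0 by rewrite ln_le0.
set u := ln y; set v := ln (2 * b); set w := ln (_ / _); nra.
Qed.

End RealEstimates.

(** * Complex moduli and the logarithmic derivative of a univariate polynomial *)

Section SliceEstimates.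
Variable R : realType.
Local Notation C := R[i].
Local Notation nc := (@Normc.normc R).
Implicit Types (b l w : C) (s : seq C) (q : {poly C}).

(** The norm of [R[i]] takes its values in [R[i]]; the estimates use the real-valued [nc], and this
    identity passes between the two. *)
Lemma normcE w : `|w| = (nc w)%:C.
Proof. by rewrite normc_def; case: w. Qed.

Lemma normc_ge0 w : 0 <= nc w.
Proof. by rewrite -ler0c -normcE. Qed.

Lemma normc_eq0 w : (nc w == 0) = (w == 0).
Proof. by rewrite -[RHS]normr_eq0 normcE -(inj_eq (@complexI R)). Qed.

Lemma normc_gt0 w : (0 < nc w) = (w != 0).
Proof. by rewrite lt_def normc_ge0 andbT normc_eq0. Qed.

Lemma normcX w n : nc (w ^+ n) = nc w ^+ n.
Proof.
by elim: n => [|n IH]; rewrite ?expr0 ?Normc.normc1// !exprS Normc.normcM IH.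
Qed.

Lemma normc_real (x : R) : nc x%:C = `|x|.
Proof. by rewrite /= expr0n addr0 sqrtr_sqr. Qed.

Lemma normc_ge_absRe w : `|complex.Re w| <= nc w.
Proof. by rewrite -lecR -normcE normc_ge_Re. Qed.

Lemma normc_ge_absIm w : `|complex.Im w| <= nc w.
Proof.
case: w => a b /=.
by rewrite -sqrtr_sqr ler_sqrt ?addr_ge0 ?sqr_ge0// lerDr sqr_ge0.
Qed.

Lemma normcB_ge b l : nc b - nc l <= nc (l - b).
Proof.
rewrite lerBlDr; have -> : b = - (l - b) + l by rewrite opprB subrK.
by apply: le_trans (le_normcD _ _) _; rewrite normcN !opprB subrK.
Qed.

Lemma normc_prod (I : Type) (r : seq I) (F : I -> C) :
  nc (\prod_(i <- r) F i) = \prod_(i <- r) nc (F i).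
Proof.
by elim/big_rec2: _ => [|i y x _ <-]; rewrite ?Normc.normc1// Normc.normcM.
Qed.

Lemma normc_sum_le (I : Type) (r : seq I) (F : I -> C) :
  nc (\sum_(i <- r) F i) <= \sum_(i <- r) nc (F i).
Proof.
elim/big_rec2: _ => [|i y x _ IH]; first by rewrite Normc.normc0.
by apply: le_trans (le_normcD _ _) _; rewrite lerD2l.
Qed.

Lemma horner_deriv_prod s l : all (fun b => l != b) s ->
  (\prod_(b <- s) ('X - b%:P))^`().[l] =
  (\prod_(b <- s) ('X - b%:P)).[l] * \sum_(b <- s) (l - b)^-1.
Proof.
elim: s => [_|b s IH /= /andP[lb ls]].
  by rewrite !big_nil -polyC1 derivC horner0 mulr0.
rewrite !big_cons derivM derivXsubC mul1r hornerD !hornerM IH// hornerXsubC.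
by rewrite mulrDr mulrAC divff ?mul1r ?subr_eq0// mulrA.
Qed.

Lemma prod_seq_ge1 (T : eqType) (s : seq T) (F : T -> R) :
  (forall c, c \in s -> 1 <= F c) -> 1 <= \prod_(c <- s) F c.
Proof.
move=> F1; rewrite big_seq; elim/big_rec: _ => // c x sc x1.
by rewrite mulr_ege1// F1.
Qed.

Lemma prod_ge_factor (T : eqType) (s : seq T) (F : T -> R) (b : T) :
  (forall c, c \in s -> 1 <= F c) -> b \in s -> F b <= \prod_(c <- s) F c.
Proof.
elim: s => // a s IH F1; rewrite big_cons inE => /orP[/eqP ->|bs].
  rewrite ler_peMr ?(le_trans ler01)// ?F1 ?mem_head//.
  by rewrite prod_seq_ge1// => c cs; rewrite F1// inE cs orbT.
apply: (le_trans (IH _ bs)) => [c cs|]; first by rewrite F1// inE cs orbT.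
rewrite ler_peMl// ?F1 ?mem_head// (le_trans ler01)// prod_seq_ge1// => c cs.
by rewrite F1// inE cs orbT.
Qed.

(** Cauchy-Schwarz against the constant sequence 1. In the induction the cross terms are absorbed by
    [2 F a F c <= F a ^ 2 + F c ^ 2]. *)
Lemma sqr_sum_le (T : Type) (s : seq T) (F : T -> R) :
  (\sum_(c <- s) F c) ^+ 2 <= (size s)%:R * \sum_(c <- s) F c ^+ 2.
Proof.
elim: s => [|a s IH]; first by rewrite !big_nil expr0n mulr0.
rewrite !big_cons /= -natr1.
suff : 2 * F a * (\sum_(c <- s) F c) <=
       (size s)%:R * F a ^+ 2 + \sum_(c <- s) F c ^+ 2.
  by move: IH; set x := \sum_(c <- s) F c; set y := \sum_(c <- s) _; nra.
have -> : (size s)%:R * F a ^+ 2 = \sum_(c <- s) F a ^+ 2.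
  by rewrite big_const_seq count_predT iter_addr_0 mulr_natl.
rewrite mulr_sumr -big_split /=; apply: ler_sum => c _.
rewrite -subr_ge0.
have -> : F a ^+ 2 + F c ^+ 2 - 2 * F a * F c = (F a - F c) ^+ 2 by ring.
exact: sqr_ge0.
Qed.

(* [q] has no zeros in the open disc, and [s] lists its roots: each factor
   [2 |b| / |l - b|] of [2 ^ n |q 0| / |q l|] is then at least [1]. *)
Lemma roots_logderiv_bound (n : nat) q : (size q <= n.+1)%N ->
  (forall w, nc w < 1 -> q.[w] != 0) ->
  exists2 s, (size s <= n)%N & (forall b, b \in s -> 1 <= nc b) /\
  forall l, nc l < 1 ->
   [/\ 0 <= ln (2 ^+ n * nc q.[0] / nc q.[l]),
       q^`().[l] / q.[l] = \sum_(b <- s) (l - b)^-1 &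
       forall b, b \in s ->
        nc (l - b) <= 2 * nc b /\
        ln (2 * nc b / nc (l - b)) <= ln (2 ^+ n * nc q.[0] / nc q.[l])].
Proof.
move=> szq q0.
have [s qE] := closed_field_poly_normal q.
have qn0 : q != 0.
  by apply: contraNneq (q0 0 _) => [->|]; rewrite ?horner0 ?Normc.normc0 ?ltr01.
have a0 : lead_coef q != 0 by rewrite lead_coef_eq0.
have qlE l : q.[l] = lead_coef q * \prod_(b <- s) (l - b).
  rewrite {1}qE hornerZ horner_prod; congr (_ * _).
  by apply: eq_bigr => b _; rewrite hornerXsubC.
have szs : (size s <= n)%N.
  by move: szq; rewrite qE size_scale// size_prod_XsubC.
have s1 b : b \in s -> 1 <= nc b.
  move=> bs; rewrite leNgt; apply: contraTN bs => /q0; apply: contraNN => bs.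
  by rewrite qlE (big_rem b)//= subrr mul0r mulr0.
exists s => //; split => // l l1.
have ls : all (fun b => l != b) s.
  apply/allP => b /s1 b1; apply: contraTneq l1 => ->.
  by rewrite -leNgt.
have lb b : b \in s -> 0 < nc (l - b).
  by move=> bs; rewrite normc_gt0 subr_eq0 (allP ls).
have lb2 b : b \in s -> nc (l - b) <= 2 * nc b.
  move=> /s1 b1; apply: le_trans (le_normcD _ _) _; rewrite normcN; lra.
have F1 b : b \in s -> 1 <= 2 * nc b / nc (l - b).
  by move=> bs; rewrite ler_pdivlMr ?mul1r ?lb ?lb2.
(* In [q 0 / q l] the leading coefficients cancel. One factor 2 goes to each root, and the
   [n - size s] factors left over can only increase the right-hand side. *)
have qratio : \prod_(b <- s) (2 * nc b / nc (l - b)) <=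
              2 ^+ n * nc q.[0] / nc q.[l].
  have -> : 2 ^+ n * nc q.[0] / nc q.[l] =
     2 ^+ (n - size s) * \prod_(b <- s) (2 * nc b / nc (l - b)).
    rewrite !qlE !Normc.normcM !normc_prod.
    rewrite big_split /= prodfV big_split /= big_const_seq count_predT.
    rewrite iter_mulr_1 -[in LHS](subnK szs) exprD.
    under eq_bigr do rewrite sub0r normcN.
    have P0 : \prod_(b <- s) nc (l - b) != 0.
      rewrite prodf_seq_neq0; apply/allP => b bs /=.
      by rewrite gt_eqF// lb.
    by field; rewrite P0 normc_eq0.
  rewrite ler_peMl ?exprn_ege1 ?ler1n// (le_trans ler01)//.
  exact: prod_seq_ge1.
have pr1 : 1 <= \prod_(b <- s) (2 * nc b / nc (l - b)).
  exact: prod_seq_ge1.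
split.
- by rewrite ln_ge0// (le_trans pr1).
- rewrite {1}qE derivZ hornerZ horner_deriv_prod// mulrA.
  rewrite -hornerZ -qE mulrAC divff ?mul1r//; exact: q0.
- move=> b bs; split; first exact: lb2.
  have Fb := prod_ge_factor F1 bs.
  rewrite ler_ln ?posrE; first exact: le_trans Fb _.
  - by rewrite (lt_le_trans ltr01)// F1.
  - by rewrite (lt_le_trans ltr01)// (le_trans pr1).
Qed.

End SliceEstimates.

(** * Limits and derivatives over [R[i]] in terms of real epsilons *)

Section ComplexTopology.
Variable R : realType.
Local Notation C := R[i].
Local Notation nc := (@Normc.normc R).

(** A positive element for the partial order of [R[i]] is real, so complex epsilons can be replaced
    by real ones. *)
Lemma gt0_complexE (e : C) : 0 < e -> e = (complex.Re e)%:C /\ 0 < complex.Re e.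
Proof.
case: e => a b; rewrite ltcE /= => /andP[/eqP -> a0].
by split.
Qed.

Lemma cvg_normcP (T : Type) (F : set_system T) (FF : Filter F) (f : T -> C)
    (l : C) :
  f x @[x --> F] --> l <->
  (forall e : R, 0 < e -> \forall x \near F, nc (f x - l) < e).
Proof.
split.
  move=> /cvgrPdist_lt fl e e0.
  have e0' : 0 < (e%:C : C) by rewrite ltcR.
  have := fl _ e0'; apply: filterS => x.
  by rewrite distrC normcE ltcR.
move=> fl; apply/cvgrPdist_lt => e /gt0_complexE[-> e0].
have := fl _ e0; apply: filterS => x.
by rewrite distrC normcE ltcR.
Qed.

Lemma nbhs_normcP (w : C) (P : set C) :
  nbhs w P <-> exists2 e : R, 0 < e & forall v, nc (v - w) < e -> P v.
Proof.
split.
  move=> /nbhs_ballP[e /= /gt0_complexE[-> e0]] wP.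
  exists (complex.Re e) => // v vw; apply: wP.
  by rewrite -ball_normE/= distrC normcE ltcR.
move=> [e e0 eP]; apply/nbhs_ballP; exists (e%:C); first by rewrite /= ltcR.
move=> v; rewrite -ball_normE/= distrC normcE ltcR; exact: eP.
Qed.

Lemma nbhs_rowP (d : nat) (z : 'rV[C]_d) (P : set 'rV[C]_d) :
  nbhs z P <->
  exists2 e : R, 0 < e & forall v : 'rV[C]_d,
    (forall j, nc (v 0 j - z 0 j) < e) -> P v.
Proof.
split.
  move=> /nbhs_ballP[e /= /gt0_complexE[-> e0]] zP.
  exists (complex.Re e) => // v vz; apply: zP.
  split=> [|i j]; first by rewrite ltcR.
  by rewrite ord1 -ball_normE/= distrC normcE ltcR.
move=> [e e0 eP]; apply/nbhs_ballP; exists (e%:C); first by rewrite /= ltcR.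
move=> v [_ zv]; apply: eP => j; have := zv 0 j.
by rewrite -ball_normE/= distrC normcE ltcR.
Qed.

Lemma continuous_Re : continuous (@complex.Re R : C -> R).
Proof.
move=> w; apply/(@cvgrPdist_lt _ R _ (nbhs w) (nbhs_filter w)) => e e0.
apply/nbhs_normcP; exists e => // v.
apply: le_lt_trans; rewrite distrC.
by have := normc_ge_absRe (v - w); case: v => ? ?; case: w => ? ?.
Qed.

Lemma continuous_Im : continuous (@complex.Im R : C -> R).
Proof.
move=> w; apply/(@cvgrPdist_lt _ R _ (nbhs w) (nbhs_filter w)) => e e0.
apply/nbhs_normcP; exists e => // v.
apply: le_lt_trans; rewrite distrC.
by have := normc_ge_absIm (v - w); case: v => ? ?; case: w => ? ?.
Qed.

Lemma normc_le_absRe_absIm (w : C) :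
  nc w <= `|complex.Re w| + `|complex.Im w|.
Proof.
case: w => a b /=.
have -> : `|a| + `|b| = Num.sqrt ((`|a| + `|b|) ^+ 2).
  by rewrite sqrtr_sqr [RHS]ger0_norm// addr_ge0.
rewrite ler_sqrt ?sqr_ge0// sqrrD !real_normK ?num_real//.
by rewrite lerD2r lerDl mulrn_wge0.
Qed.

Lemma cvg_complex (T : Type) (F : set_system T) (FF : Filter F) (f g : T -> R)
    (a b : R) :
  f x @[x --> F] --> a -> g x @[x --> F] --> b ->
  (f x +i* g x : C) @[x --> F] --> (a +i* b : C).
Proof.
move=> /cvgrPdist_lt fa /cvgrPdist_lt gb; apply/cvg_normcP => e e0.
have e20 : 0 < e / 2 by rewrite divr_gt0.
apply: filterS2 (fa _ e20) (gb _ e20) => x fx gx.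
apply: le_lt_trans (normc_le_absRe_absIm _) _ => /=.
by rewrite distrC [`|g x - b|]distrC; lra.
Qed.

Lemma continuous_normc : continuous nc.
Proof.
move=> w; apply/(@cvgrPdist_lt _ R _ (nbhs w) (nbhs_filter w)) => e e0.
apply/nbhs_normcP; exists e => // v.
apply: le_lt_trans; rewrite ler_norml; apply/andP; split.
  have := normcB_ge v w; rewrite -(opprB v w) normcN; lra.
exact: normcB_ge.
Qed.

(** Clearing the denominator [h] gives a first-order expansion that also makes sense at [h = 0]; the
    derivatives of [cexp] and [principal_log] are then checked by inequalities. *)
Lemma is_derive_normcP (f : C -> C) (w df : C) :
  is_derive w 1 f df <->
  (forall e : R, 0 < e -> exists2 r : R, 0 < r &
    forall h, nc h < r -> nc (f (w + h) - f w - df * h) <= e * nc h).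
Proof.
split.
  move=> [/= fw <-] e e0.
  have /cvg_normcP/(_ _ e0) : 
    (h^-1 *: ((f \o shift w) (h *: 1) - f w)) @[h --> 0^'] --> 'D_1 f w by [].
  rewrite near_withinE => /nbhs_normcP[r r0 hr]; exists r => // h hr'.
  have [->|h0] := eqVneq h 0.
    by rewrite addr0 subrr mulr0 subr0 Normc.normc0 mulr0.
  have {}hr := hr h; rewrite subr0 in hr; have /ltW := hr hr' h0.
  rewrite /= /GRing.scale /= mulr1 [h + w]addrC -ler_pdivrMr ?normc_gt0//.
  apply: le_trans; rewrite -Normc.normcV -Normc.normcM mulrBl mulfK//.
  by rewrite mulrC.
move=> H.
suff cv : (h^-1 *: ((f \o shift w) (h *: 1) - f w)) @[h --> 0^'] --> df.
  by apply: DeriveDef; [apply/cvg_ex; exists df|exact/cvg_lim].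
apply/cvg_normcP => e e0.
(* Half of [e], because the expansion gives a non-strict bound and the limit asks for a strict
   one. *)
have [|r r0 hr] := H (e / 2); first by rewrite divr_gt0.
rewrite near_withinE; apply/nbhs_normcP; exists r => // h; rewrite subr0.
move=> /hr {}hr h0; rewrite /= /GRing.scale /= mulr1 [h + w]addrC.
have nh0 : 0 < nc h by rewrite normc_gt0.
have E : h^-1 * (f (w + h) - f w) - df = (f (w + h) - f w - df * h) * h^-1.
  by rewrite mulrBl mulfK// mulrC.
rewrite E Normc.normcM Normc.normcV ltr_pdivrMr//.
by apply: (le_lt_trans hr); rewrite ltr_pM2r// ltr_pdivrMr// ltr_pMr ?ltr1n.
Qed.

End ComplexTopology.

(** * The complex exponential and the principal logarithm *)

Section ComplexExpLog.
Variable R : realType.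
Local Notation C := R[i].
Local Notation nc := (@Normc.normc R).

Lemma cexpD (a b : C) : cexp (a + b) = cexp a * cexp b.
Proof.
case: a b => [a1 a2] [b1 b2]; rewrite /cexp /= expRD cosD sinD.
by apply/eqP; rewrite eq_complex /=; apply/andP; split; apply/eqP; ring.
Qed.

Lemma cexp0 : cexp (0 : C) = 1.
Proof. by rewrite /cexp /= expR0 cos0 sin0 mul1r mulr0. Qed.

Lemma normc_cexp (w : C) : nc (cexp w) = expR (complex.Re w).
Proof.
rewrite /cexp /= !exprMn -mulrDr cos2Dsin2 mulr1.
by rewrite sqrtr_sqr gtr0_norm// expR_gt0.
Qed.

Lemma cexp_neq0 (w : C) : cexp w != 0.
Proof. by rewrite -normc_gt0 normc_cexp expR_gt0. Qed.

Lemma is_derive_real_approx (f : R -> R) (df : R) :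
  is_derive (0 : R) (1 : R) f df ->
  forall e : R, 0 < e -> exists2 r : R, 0 < r &
    forall h, `|h| < r -> `|f h - f 0 - df * h| <= e * `|h|.
Proof.
move=> [/= f0 <-] e e0.
have /cvgrPdist_lt/(_ _ e0) :
  (h^-1 *: ((f \o shift 0) (h *: 1) - f 0)) @[h --> 0^'] --> 'D_1 f 0 by [].
rewrite near_withinE => /nbhs_ballP[r /= r0 hr]; exists r => // h hr'.
have [->|h0] := eqVneq h 0; first by rewrite subrr mulr0 subr0 normr0 mulr0.
have {}hr := hr h; rewrite -ball_normE/= sub0r normrN in hr.
have /ltW := hr hr' h0.
rewrite /= /GRing.scale /= mulr1 addr0 -ler_pdivrMr ?normr_gt0//.
rewrite distrC; apply: le_trans; rewrite -normfV -normrM mulrBl mulfK//.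
by rewrite mulrC.
Qed.

Lemma is_derive_cexp0 : is_derive (0 : C) 1 (@cexp R) 1.
Proof.
apply/is_derive_normcP => e e0.
(* Here 9 = 4 + 5, the multiples of [k N] that bound the errors of the real and imaginary parts;
   [k <= 1] ensures [expR x <= 3]. *)
pose k := Num.min 1 (e / 9).
have k0 : 0 < k by rewrite lt_min ltr01 divr_gt0.
have k1 : k <= 1 by rewrite ge_min lexx.
have ke : k <= e / 9 by rewrite ge_min lexx orbT.
clearbody k.
have [r1 r10 he] := is_derive_real_approx (is_derive_expR 0) k0.
have [r2 r20 hc] := is_derive_real_approx (is_derive_cos 0) k0.
have [r3 r30 hs] := is_derive_real_approx (is_derive_sin 0) k0.
(* Requiring [nc h < k] makes the quadratic term [(expR x - 1) y] at most [2 k N]. *)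
exists (Num.min k (Num.min r1 (Num.min r2 r3))).
  by rewrite !lt_min k0 r10 r20.
move=> h; rewrite !lt_min => /and4P[hk h1 h2 h3].
have := normc_ge_absRe h; have := normc_ge_absIm h.
rewrite add0r cexp0 mul1r => him hre.
apply: le_trans (normc_le_absRe_absIm _) _.
case: h hk h1 h2 h3 him hre => x y.
set N := nc _ => hk h1 h2 h3 /= Ny Nx.
have {}he := he x (le_lt_trans Nx h1).
have {}hc := hc y (le_lt_trans Ny h2).
have {}hs := hs y (le_lt_trans Ny h3).
rewrite expR0 mul1r in he; rewrite cos0 sin0 oppr0 mul0r subr0 in hc.
rewrite sin0 cos0 mul1r subr0 in hs.
rewrite subr0.
have x0 := normr_ge0 x; have y0 := normr_ge0 y.
have kN : k * N <= e / 9 * N by rewrite ler_wpM2r// normc_ge0.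
have kx : k * `|x| <= k * N by rewrite ler_wpM2l// ltW.
have ky : k * `|y| <= k * N by rewrite ler_wpM2l// ltW.
have xx : `|expR x - 1| <= 2 * `|x|.
  have -> : expR x - 1 = (expR x - 1 - x) + x by ring.
  apply: le_trans (ler_normD _ _) _.
  have : k * `|x| <= 1 * `|x| by rewrite ler_wpM2r.
  lra.
have ex3 : expR x <= 3.
  have := ler_norm (expR x - 1); lra.
have ex0 := expR_gt0 x.
have re : `|expR x * cos y - 1 - x| <= 4 * (k * N).
  have -> : expR x * cos y - 1 - x = (expR x - 1 - x) + expR x * (cos y - 1).
    by ring.
  apply: le_trans (ler_normD _ _) _; rewrite normrM gtr0_norm//.
  have : expR x * `|cos y - 1| <= 3 * (k * N).
    by apply: ler_pM => //; exact: le_trans hc ky.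
  lra.
have im : `|expR x * sin y - y| <= 5 * (k * N).
  have -> : expR x * sin y - y = expR x * (sin y - y) + (expR x - 1) * y.
    by ring.
  apply: le_trans (ler_normD _ _) _; rewrite normrM gtr0_norm// normrM.
  have : expR x * `|sin y - y| <= 3 * (k * N).
    by apply: ler_pM => //; exact: le_trans hs ky.
  have : `|expR x - 1| * `|y| <= (2 * k) * N.
    by apply: ler_pM => //; lra.
  lra.
lra.
Qed.

Lemma is_derive_cexp (w : C) : is_derive w 1 (@cexp R) (cexp w).
Proof.
apply/is_derive_normcP => e e0.
have [|r r0 hr] := (@is_derive_normcP R _ 0 1).1 is_derive_cexp0
                     (e / nc (cexp w)).
  by rewrite divr_gt0// normc_gt0 cexp_neq0.
exists r => // h /hr; rewrite add0r cexp0 mul1r cexpD => {}hr.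
have -> : cexp w * cexp h - cexp w - cexp w * h = cexp w * (cexp h - 1 - h).
  by ring.
by rewrite Normc.normcM mulrC -ler_pdivlMr ?normc_gt0 ?cexp_neq0// mulrAC.
Qed.

(** Since [sin (acos x) = sqrt (1 - x ^ 2)], the arccosine alone recovers only [|Im w|]; the sign
    test in [principal_arg] restores the sign. *)
Lemma cos_sin_principal_arg (w : C) : w != 0 ->
  nc w * cos (principal_arg w) = complex.Re w /\
  nc w * sin (principal_arg w) = complex.Im w.
Proof.
move=> w0; have n0 : 0 < nc w by rewrite normc_gt0.
set x := complex.Re w / nc w.
have x1 : -1 <= x <= 1.
  rewrite -ler_norml normrM normfV (gtr0_norm n0) ler_pdivrMr// mul1r.
  exact: normc_ge_absRe.
have nx : nc w * x = complex.Re w by rewrite mulrCA divff ?mulr1// gt_eqF.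
have sx : nc w * Num.sqrt (1 - x ^+ 2) = `|complex.Im w|.
  rewrite -{1}[nc w](ger0_norm (normc_ge0 w)) -sqrtr_sqr -sqrtrM ?sqr_ge0//.
  rewrite mulrBr mulr1 -exprMn nx -sqrtr_sqr; congr Num.sqrt.
  by case: (w) => a b /=; rewrite sqr_sqrtr ?addr_ge0 ?sqr_ge0//; ring.
rewrite /principal_arg -/x; case: ifPn => im.
  by rewrite acosK ?in_itv//= sin_acos// sx ger0_norm.
rewrite cosN sinN acosK ?in_itv//= sin_acos// mulrN sx ltr0_norm ?opprK//.
by rewrite ltNge.
Qed.

Lemma principal_logK (w : C) : w != 0 -> cexp (principal_log w) = w.
Proof.
move=> w0; have [cw sw] := cos_sin_principal_arg w0.
rewrite /cexp /principal_log /= lnK ?posrE ?normc_gt0// cw sw.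
by case: w {w0 cw sw}.
Qed.

(** The definition by [acos] and a case distinction hides the continuity across the positive real
    axis; the form by [asin] shows it. It is valid because the argument lies in [[- pi / 2, pi / 2]]
    there. *)
Lemma principal_arg_asin (w : C) : 0 < complex.Re w ->
  principal_arg w = asin (complex.Im w / nc w).
Proof.
move=> re0.
have w0 : w != 0 by apply: contraTneq re0 => ->; rewrite ltxx.
have n0 : 0 < nc w by rewrite normc_gt0.
have [_ <-] := cos_sin_principal_arg w0.
rewrite mulrC mulKf ?gt_eqF// sinK//.
set x := complex.Re w / nc w.
have x1 : 0 < x <= 1.
  rewrite divr_gt0//= ler_pdivrMr// mul1r (le_trans (ler_norm _))//.
  exact: normc_ge_absRe.
have [x0 xle1] := andP x1.
have x1' : -1 <= x <= 1 by apply/andP; split; lra.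
have ac : 0 <= acos x <= pi / 2.
  rewrite acos_ge0//= leNgt; apply/negP => px.
  move: px; rewrite -ltr_cos ?in_itv/= ?acos_ge0 ?acos_lepi//; last first.
    by rewrite divr_ge0 ?pi_ge0//= ler_pdivrMr// ler_peMr ?pi_ge0 ?ler1n.
  by rewrite acosK ?in_itv//= cos_pihalf; lra.
rewrite in_itv /= /principal_arg -/x; case: ifPn => _; lra.
Qed.

Lemma cvg_ln_asin (T : Type) (F : set_system T) (FF : Filter F)
    (f g : T -> R) (a b : R) : 0 < a -> -1 < b / a < 1 ->
  f x @[x --> F] --> a -> g x @[x --> F] --> b ->
  (ln (f x) +i* asin (g x / f x) : C) @[x --> F] -->
  (ln a +i* asin (b / a) : C).
Proof.
move=> a0 ba fa gb; apply: cvg_complex.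
  by apply: (@continuous_cvg _ _ _ _ _ _ (@ln R)) => //; exact: continuous_ln.
apply: (@continuous_cvg _ _ _ _ _ _ (@asin R)); first exact: continuous_asin.
by apply: cvgM => //; apply: cvgV => //; rewrite gt_eqF.
Qed.

Lemma cvg_principal_log (w : C) : 0 < complex.Re w ->
  principal_log v @[v --> w] --> principal_log w.
Proof.
move=> re0.
have w0 : w != 0 by apply: contraTneq re0 => ->; rewrite ltxx.
have n0 : 0 < nc w by rewrite normc_gt0.
have nw : nc v @[v --> w] --> nc w by exact: continuous_normc.
have imw : complex.Im v @[v --> w] --> complex.Im w by exact: continuous_Im.
have as1 : -1 < complex.Im w / nc w < 1.
  rewrite -ltr_norml normrM normfV (gtr0_norm n0) ltr_pdivrMr// mul1r.
  rewrite -(ltr_pXn2r (ltn0Sn 1)) ?nnegrE ?normr_ge0 ?normc_ge0//.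
  rewrite real_normK ?num_real//; case: (w) re0 => a b /= a0.
  by rewrite sqr_sqrtr ?addr_ge0 ?sqr_ge0// ltrDr exprn_gt0.
suff : (ln (nc v) +i* asin (complex.Im v / nc v)) @[v --> w] -->
       (principal_log w : C).
  apply: cvg_trans; apply: near_eq_cvg; first exact: (nbhs_filter w).
  have re_near : \forall v \near w, 0 < complex.Re v.
    have := @continuous_Re R w; move/(@cvgr_gt R _ (nbhs w) _ _ _); exact.
  apply: (@filterS _ _ (nbhs_filter w) _ _ _ re_near) => v v0.
  by rewrite /principal_log principal_arg_asin.
rewrite /principal_log principal_arg_asin//.
exact: (@cvg_ln_asin _ (nbhs w) (nbhs_filter w)).
Qed.

(** Inverse function argument: the increment [k] of the logarithm is small by continuity, and
    expanding [cexp] at [principal_log w] gives [h = w k] up to an error [e' nc k]. *)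
Lemma is_derive_principal_log (w : C) : 0 < complex.Re w ->
  is_derive w 1 (@principal_log R) w^-1.
Proof.
move=> re0.
have w0 : w != 0 by apply: contraTneq re0 => ->; rewrite ltxx.
have n0 : 0 < nc w by rewrite normc_gt0.
apply/is_derive_normcP => e e0.
(* The first bound absorbs the error and yields [nc k <= 2 nc h / nc w]; the second then turns
   [e' nc k / nc w] into at most [e nc h]. *)
pose e' := Num.min (nc w / 2) (e * nc w ^+ 2 / 2).
have e'0 : 0 < e' by rewrite lt_min !divr_gt0 ?mulr_gt0// exprn_gt0.
have e'1 : e' <= nc w / 2 by rewrite ge_min lexx.
have e'2 : e' <= e * nc w ^+ 2 / 2 by rewrite ge_min lexx orbT.
have [r1 r10 hr1] :=
  (@is_derive_normcP R _ _ _).1 (is_derive_cexp (principal_log w)) _ e'0.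
have /cvg_normcP/(_ _ r10)/nbhs_normcP[r2 r20 hr2] := cvg_principal_log re0.
have [r3 r30 hr3] : exists2 r : R, 0 < r &
    forall h, nc h < r -> 0 < complex.Re (w + h).
  exists (complex.Re w) => // h hw.
  have -> : complex.Re (w + h) = complex.Re w + complex.Re h.
    by case: (w) (h) => [? ?] [? ?].
  by have := ler_norm (- complex.Re h); rewrite normrN;
    have := normc_ge_absRe h; lra.
exists (Num.min r2 r3); first by rewrite lt_min r20.
move=> h; rewrite lt_min => /andP[h2 /hr3 reh].
have wh0 : w + h != 0 by apply: contraTneq reh => ->; rewrite ltxx.
set k := principal_log (w + h) - principal_log w.
have : nc k < r1 by apply: hr2; rewrite addrC addKr.
move=> /hr1; rewrite [_ + k]addrC subrK !principal_logK//.
rewrite [w + h]addrC addrK => hk.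
have E : k - w^-1 * h = - ((h - w * k) / w).
  by rewrite mulrBl [w * k]mulrC mulfK// opprB mulrC.
have kE : k = w^-1 * h - (h - w * k) / w by rewrite -E; ring.
have nk : nc k <= nc h / nc w + nc k / 2.
  rewrite {1}kE; apply: le_trans (le_normcD _ _) _.
  rewrite normcN !Normc.normcM !Normc.normcV mulrC lerD2l ler_pdivrMr//.
  apply: (le_trans hk); rewrite mulrC -mulrA; apply: ler_wpM2l.
    exact: normc_ge0.
  by rewrite mulrC.
have nk2 : nc k <= 2 * (nc h / nc w) by lra.
rewrite E normcN Normc.normcM Normc.normcV ler_pdivrMr//.
apply: (le_trans hk).
apply: (le_trans (ler_wpM2l (ltW e'0) nk2)).
have : e' * (nc h / nc w) <= e * nc w ^+ 2 / 2 * (nc h / nc w).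
  by apply: ler_wpM2r => //; rewrite divr_ge0 ?normc_ge0.
have -> : e * nc w ^+ 2 / 2 * (nc h / nc w) = e * nc h * nc w / 2.
  by field; rewrite gt_eqF.
lra.
Qed.

End ComplexExpLog.

(** * Borel measurability on [C^d] *)

Section RowMeasurability.
Variables (R : realType) (d : nat).
Local Notation C := R[i].
Local Notation nc := (@Normc.normc R).

Lemma open_borelC (A : set 'rV[C]_d) :
  open A -> measurable (A : set (borelC R d)).
Proof. by move=> oA; exact: sub_sigma_algebra. Qed.

(** Rays []x, +oo[] generate the Borel sets of [R], and their preimages in [D] are open. *)
Lemma open_cvg_measurable_fun (D : set 'rV[C]_d) (g : 'rV[C]_d -> R) :
  open D -> (forall z, D z -> g v @[v --> z] --> g z) ->
  measurable_fun (D : set (borelC R d)) (g : borelC R d -> R).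
Proof.
move=> oD gD; apply: (measurability _ (RGenOInfty.measurableE R)).
move=> _ [_ [x ->] <-]; apply: open_borelC.
rewrite openE => z [Dz]; rewrite /= in_itv/= andbT => gx.
apply: filterI; first exact: open_nbhs_nbhs.
have := gD z Dz; move/(@cvgr_gt R _ (nbhs z) _ _ _)/(_ _ gx).
by apply: filterS => v /=; rewrite in_itv/= andbT.
Qed.

(** A countable base of the topology of [C^d], obtained from its [2 d] real coordinates. *)
Definition rational_box (c : {ffun 'I_d -> rat * rat}) (k : nat)
    : set 'rV[C]_d :=
  [set v | forall j, `|complex.Re (v 0 j) - ratr (c j).1| < k.+1%:R^-1 /\
                     `|complex.Im (v 0 j) - ratr (c j).2| < k.+1%:R^-1].

Lemma rational_box_nbhs (O : set 'rV[C]_d) (z : 'rV[C]_d) : nbhs z O ->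
  exists c k, rational_box c k z /\ rational_box c k `<=` O.
Proof.
move=> /nbhs_rowP[e e0 eO].
(* A quarter of [e]: the real and the imaginary parts are both compared through a rational centre,
   which makes four errors. *)
have [k ke] : exists k : nat, k.+1%:R^-1 < e / 4.
  have e4 : 0 < e / 4 by rewrite divr_gt0.
  exists (Num.truncn (e / 4)^-1).
  rewrite invf_plt ?posrE//.
  by rewrite truncnS_gt.
have approx (x : R) : {q : rat | `|x - ratr q| < k.+1%:R^-1}.
  apply: cid.
  have : 0 < k.+1%:R^-1 :> R by rewrite invr_gt0 ltr0n.
  move: (k.+1%:R^-1) => r r0.
  have /rat_in_itvoo[q] : x - r < x + r by lra.
  rewrite in_itv/= => /andP[q1 q2]; exists q.
  by rewrite ltr_norml; apply/andP; split; lra.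
exists [ffun j => (sval (approx (complex.Re (z 0 j))),
                   sval (approx (complex.Im (z 0 j))))], k.
split=> [j|v vb].
  rewrite ffunE /=; split; first exact: (svalP (approx (complex.Re (z 0 j)))).
  exact: (svalP (approx (complex.Im (z 0 j)))).
apply: eO => j; have := vb j; rewrite ffunE /=.
have := svalP (approx (complex.Re (z 0 j))).
have := svalP (approx (complex.Im (z 0 j))).
move: (sval _) (sval _) => q1 q2 h1 h2 [h3 h4].
apply: le_lt_trans (normc_le_absRe_absIm _) _.
have -> : complex.Re (v 0 j - z 0 j) = complex.Re (v 0 j) - complex.Re (z 0 j).
  by case: (v 0 j) (z 0 j) => [? ?] [? ?].
have -> : complex.Im (v 0 j - z 0 j) = complex.Im (v 0 j) - complex.Im (z 0 j).
  by case: (v 0 j) (z 0 j) => [? ?] [? ?].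
move: ke h1 h2 h3 h4; move: (k.+1%:R^-1) => r re; rewrite !ltr_norml.
set a := complex.Re (v 0 j); set b := complex.Re (z 0 j).
set a' := complex.Im (v 0 j); set b' := complex.Im (z 0 j).
move=> /andP[? ?] /andP[? ?] /andP[? ?] /andP[? ?].
have : `|a - b| < e / 2 by rewrite ltr_norml; apply/andP; split; lra.
have : `|a' - b'| < e / 2 by rewrite ltr_norml; apply/andP; split; lra.
lra.
Qed.

(** Every open set is a countable union of rational boxes, and the preimage of a box is a finite
    intersection of conditions on real coordinates. *)
Lemma measurable_fun_row (dd : measure_display) (T : measurableType dd)
    (f : T -> 'rV[C]_d) :
  (forall j, measurable_fun setT (fun x => complex.Re (f x 0 j))) ->
  (forall j, measurable_fun setT (fun x => complex.Im (f x 0 j))) ->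
  measurable_fun setT (f : T -> borelC R d).
Proof.
move=> mRe mIm.
have mbox c k : measurable (f @^-1` rational_box c k).
  have -> : f @^-1` rational_box c k = \bigcap_(j in [set: 'I_d])
     (((fun x => complex.Re (f x 0 j)) @^-1`
        (ball (ratr (c j).1 : R) k.+1%:R^-1)) `&`
      ((fun x => complex.Im (f x 0 j)) @^-1`
        (ball (ratr (c j).2 : R) k.+1%:R^-1))).
    apply/seteqP; split => x /=.
      move=> h j _; have [h1 h2] := h j.
      by split; rewrite /= -ball_normE/= distrC.
    move=> h j; have [/=] := h j I.
    by rewrite -!ball_normE/= distrC => ?; rewrite distrC => ?.
  apply: fin_bigcap_measurable => // j _; apply: measurableI.
    rewrite -[X in measurable X]setTI; apply: mRe => //.
    by apply: open_measurable; exact: ball_open.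
  rewrite -[X in measurable X]setTI; apply: mIm => //.
  by apply: open_measurable; exact: ball_open.
apply: (@measurability _ _ T (borelC R d) [set: T] f (@open 'rV[C]_d)) => //.
move=> _ [U oU <-]; rewrite setTI.
(* Boxes not contained in [U] contribute the empty set, so that the union runs over a whole
   countable type. *)
pose F (ck : {ffun 'I_d -> rat * rat} * nat) :=
  if `[< rational_box ck.1 ck.2 `<=` U >] then f @^-1` rational_box ck.1 ck.2
  else set0.
have -> : f @^-1` U = \bigcup_ck F ck.
  apply/seteqP; split => x /=.
    move=> Ux; have [|c [k [fb bU]]] := @rational_box_nbhs U (f x).
      exact: open_nbhs_nbhs.
    by exists (c, k) => //; rewrite /F; case: asboolP.
  move=> [ck _]; rewrite /F; case: asboolP => // bU /= fb.
  exact: bU.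
apply: countable_bigcupT_measurable => [|ck]; first exact: countableP.
by rewrite /F; case: asboolP.
Qed.

End RowMeasurability.

(** * Limits of polynomial expressions in coordinates *)

Lemma cvg_sum_sqr (K : numFieldType) (I T : Type) (F : set_system T)
    (FF : Filter F) (f : I -> T -> K) (a : I -> K) (s : seq I) :
  (forall i, f i x @[x --> F] --> a i) ->
  (\sum_(i <- s) f i x ^+ 2) @[x --> F] --> (\sum_(i <- s) a i ^+ 2).
Proof.
move=> fa; elim: s => [|i s IH].
  by rewrite big_nil; under eq_fun do rewrite big_nil; exact: cvg_cst.
rewrite big_cons; under eq_fun do rewrite big_cons.
by apply: cvgD => //; apply: cvgM.
Qed.

Lemma cvg_sum_monomials (K : numFieldType) (d : nat) (T : Type)
    (F : set_system T) (FF : Filter F)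
    (f : 'I_d -> T -> K) (a : 'I_d -> K) (s : seq (mpoly.multinom d))
    (c : mpoly.multinom d -> K) :
  (forall i, f i x @[x --> F] --> a i) ->
  (\sum_(m <- s) c m * \prod_i f i x ^+ mpoly.fun_of_multinom m i)
     @[x --> F] -->
  (\sum_(m <- s) c m * \prod_i a i ^+ mpoly.fun_of_multinom m i).
Proof.
move=> fa; elim: s => [|m s IH].
  by rewrite big_nil; under eq_fun do rewrite big_nil; exact: cvg_cst.
rewrite big_cons; under eq_fun do rewrite big_cons.
apply: cvgD => //; apply: cvgM; first exact: cvg_cst.
elim: (index_enum _) => [|i r IHr].
  by rewrite big_nil; under eq_fun do rewrite big_nil; exact: cvg_cst.
rewrite big_cons; under eq_fun do rewrite big_cons.
apply: cvgM => //; elim: (mpoly.fun_of_multinom m i) => [|k IHk].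
  by rewrite expr0; under eq_fun do rewrite expr0; exact: cvg_cst.
by rewrite exprS; under eq_fun do rewrite exprS; exact: cvgM.
Qed.

(** * Restriction of a polynomial to complex lines through the origin, and the unit ball *)

Section Slices.
Variables (R : realType) (d : nat).
Local Notation C := R[i].
Local Notation nc := (@Normc.normc R).
Implicit Types (z : 'rV[C]_d) (p : mpoly.mpoly d C) (l : C).

Definition monomial_eval (m : mpoly.multinom d) z : C :=
  \prod_i z 0 i ^+ mpoly.fun_of_multinom m i.

Lemma monomial_evalZ m l z :
  monomial_eval m (l *: z) = l ^+ mpoly.mdeg m * monomial_eval m z.
Proof.
rewrite /monomial_eval mpoly.mdegE -prodrXr -big_split /=.
by apply: eq_bigr => i _; rewrite mxE exprMn.
Qed.

Lemma cpoly_evalE p z :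
  cpoly_eval p z =
  \sum_(m <- mpoly.msupp p) mpoly.mcoeff m p * monomial_eval m z.
Proof. exact: mpoly.mevalE. Qed.

(** The map [l |-> p (l z)] as a polynomial in [l]; written by monomials, it shows both its degree
    and its derivative. *)
Definition slice p z : {poly C} :=
  \sum_(m <- mpoly.msupp p)
    (mpoly.mcoeff m p * monomial_eval m z) *: 'X^(mpoly.mdeg m).

(* The radial derivative of [p], by Euler's formula on monomials. *)
Definition euler p z : C :=
  \sum_(m <- mpoly.msupp p)
    ((mpoly.mdeg m)%:R * mpoly.mcoeff m p) * monomial_eval m z.

Lemma horner_slice p z l : (slice p z).[l] = cpoly_eval p (l *: z).
Proof.
rewrite horner_sum cpoly_evalE; apply: eq_bigr => m _.
by rewrite hornerZ hornerXn monomial_evalZ mulrAC mulrA.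
Qed.

Lemma size_slice p z : (size (slice p z) <= (total_degree p).+1)%N.
Proof.
rewrite /slice big_seq; apply: (leq_trans (size_sum _ _ _)).
apply/bigmax_leqP_seq => m _ mp.
apply: (leq_trans (size_scale_leq _ _)); rewrite size_polyXn.
have := mpoly.msize_mdeg_lt mp; rewrite /total_degree.
by case: (mpoly.mmeasure _ _).
Qed.

(** Differentiation lowers each exponent by one and the factor [l] restores it. *)
Lemma horner_deriv_slice p z l :
  l * (slice p z)^`().[l] = euler p (l *: z).
Proof.
rewrite /slice raddf_sum /= horner_sum mulr_sumr; apply: eq_bigr => m _.
rewrite derivZ derivXn hornerZ hornerMn hornerXn monomial_evalZ.
case: (mpoly.mdeg m) => [|k]; first by rewrite mulr0n !(mul0r, mulr0).
rewrite -mulr_natl exprS /=; ring.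
Qed.

Lemma is_derive_horner (q : {poly C}) (x : C) :
  is_derive x 1 (horner q) q^`().[x].
Proof.
elim/poly_ind: q => [|q c IH].
  have -> : horner (0 : {poly C}) = cst 0.
    by apply/funext => y /=; rewrite horner0.
  by rewrite deriv0 horner0; exact: is_derive_cst.
have -> : horner (q * 'X + c%:P) = (horner q * id + cst c : C -> C).
  by apply/funext => y; rewrite !hornerE.
have -> : (q * 'X + c%:P)^`().[x] = q.[x] *: 1 + x *: q^`().[x] + 0.
  rewrite derivD derivM derivC derivX !hornerE /GRing.scale /=; ring.
exact: is_deriveD (is_deriveM IH (is_derive_id x 1)) (is_derive_cst c x 1).
Qed.

(** As [p (z + h z)] is the slice at [1 + h], the difference quotients of [p] at [z] along [z] are
    those of a univariate polynomial at 1. *)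
Lemma is_derive_cpoly_eval p z : is_derive z z (@cpoly_eval R d p) (euler p z).
Proof.
have [h1 h2] := is_derive_horner (slice p z) 1.
have E : (fun h : C => h^-1 *: ((@cpoly_eval R d p \o shift z) (h *: z) -
                           cpoly_eval p z)) =
    (fun h : C => h^-1 *: ((horner (slice p z) \o shift 1) (h *: 1) -
                           (slice p z).[1])).
  apply/funext => h /=; rewrite !horner_slice scale1r; congr (_ *: (_ - _)).
  by congr cpoly_eval; rewrite scalerDl scale1r /GRing.scale /= mulr1.
have -> : euler p z = (slice p z)^`().[1].
  by rewrite -[LHS]/(euler p z) -[z in LHS]scale1r -horner_deriv_slice mul1r.
apply: DeriveDef; first by rewrite /derivable E.
by rewrite -h2 /derive E.
Qed.

Lemma cvg_cpoly_eval p z : cpoly_eval p v @[v --> z] --> cpoly_eval p z.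
Proof.
rewrite cpoly_evalE; under eq_fun do rewrite cpoly_evalE.
apply: (@cvg_sum_monomials _ _ _ (nbhs z) (nbhs_filter z)
  (fun i (v : 'rV[C]_d) => v 0 i) (fun i => z 0 i)) => i.
exact: coord_continuous.
Qed.

Lemma cvg_euler p z : euler p v @[v --> z] --> euler p z.
Proof.
apply: (@cvg_sum_monomials _ _ _ (nbhs z) (nbhs_filter z)
  (fun i (v : 'rV[C]_d) => v 0 i) (fun i => z 0 i)) => i.
exact: coord_continuous.
Qed.

Lemma sqnormCZ l z : sqnormC (l *: z) = nc l ^+ 2 * sqnormC z.
Proof.
rewrite /sqnormC mulr_sumr; apply: eq_bigr => j _.
by rewrite mxE Normc.normcM exprMn.
Qed.

Lemma sqnormC_ge0 z : 0 <= sqnormC z.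
Proof. by rewrite /sqnormC sumr_ge0// => j _; rewrite sqr_ge0. Qed.

Lemma cvg_sqnormC z : sqnormC v @[v --> z] --> sqnormC z.
Proof.
rewrite /sqnormC.
apply: (@cvg_sum_sqr _ _ _ (nbhs z) (nbhs_filter z)
  (fun j (v : 'rV[C]_d) => nc (v 0 j))) => j.
apply: (@cvg_comp _ _ _ (fun v : 'rV[C]_d => v 0 j) nc (nbhs z)
  (nbhs (z 0 j))); first exact: coord_continuous.
exact: continuous_normc.
Qed.

Lemma open_unit_ball : open (@unit_ball R d).
Proof.
rewrite openE => z /= z1; have := @cvg_sqnormC z.
by move/(@cvgr_lt R _ (nbhs z) _ _ _)/(_ _ z1).
Qed.

Lemma unit_ballZ z l : sqnormC z <= 1 -> nc l < 1 -> unit_ball (l *: z).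
Proof.
move=> z1 l1; rewrite /unit_ball /= sqnormCZ.
apply: (@le_lt_trans _ _ (nc l ^+ 2)).
  by rewrite ler_piMr ?sqr_ge0.
by rewrite expr_lt1// normc_ge0.
Qed.

Lemma unit_ball_scaled z : unit_ball z ->
  exists l z', [/\ nc l < 1, sqnormC z' <= 1 & z = l *: z'].
Proof.
rewrite /unit_ball /= => z1; have z0 := sqnormC_ge0 z.
(* This mean lies below 1, is positive even at [z = 0], and its square is at least [sqnormC z] by
   the arithmetic-geometric inequality. *)
pose r := (1 + sqnormC z) / 2.
have r0 : 0 < r by rewrite /r; lra.
have nr : nc r%:C = r by rewrite normc_real gtr0_norm.
have rC0 : r%:C != 0 :> C by rewrite -normc_gt0 nr.
exists r%:C, (r%:C^-1 *: z); split.
- by rewrite nr /r; lra.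
- rewrite sqnormCZ Normc.normcV nr exprVn mulrC ler_pdivrMr ?exprn_gt0//.
  rewrite mul1r /r -subr_ge0.
  have -> : ((1 + sqnormC z) / 2) ^+ 2 - sqnormC z = ((1 - sqnormC z) / 2) ^+ 2.
    by field.
  exact: sqr_ge0.
- by rewrite scalerA divff// scale1r.
Qed.

End Slices.

(** * Quotients, chain rule and product rule for scalar-valued functions *)

Lemma cvg_quotient (K : numFieldType) (T : Type) (F : set_system T)
    (FF : Filter F) (f g h : T -> K) (a b c : K) :
  f x @[x --> F] --> a -> g x @[x --> F] --> b -> h x @[x --> F] --> c ->
  b != 0 -> 1 + c != 0 ->
  (- f x / (g x * (1 + h x))) @[x --> F] --> - a / (b * (1 + c)).
Proof.
move=> fa gb hc b0 c0; apply: cvgM; first exact: cvgN.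
apply: cvgV; first by rewrite mulf_neq0.
by apply: cvgM => //; apply: cvgD => //; exact: cvg_cst.
Qed.

(** Linearity of the differential at the decomposition of [z] in the standard basis; the radial
    derivative is thus the derivative along [z] itself. *)
Lemma sum_derive_delta (K : numFieldType) (d : nat) (f : 'rV[K]_d -> K)
    (z : 'rV[K]_d) : differentiable f z ->
  \sum_(j < d) z 0 j * 'D_(delta_mx 0 j) f z = 'D_z f z.
Proof.
move=> df; rewrite deriveE//.
rewrite [X in _ = 'd f z X](row_sum_delta z) linear_sum /=.
by apply: eq_bigr => j _; rewrite linearZ deriveE.
Qed.

Lemma derive_comp_scalar (K : numFieldType) (V : normedModType K) (f : K -> K)
    (g : V -> K) (z v : V) : differentiable g z -> differentiable f (g z) ->
  'D_v (f \o g) z = 'D_1 f (g z) * 'D_v g z.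
Proof.
move=> dg df; have dfg : differentiable (f \o g) z.
  exact: differentiable_comp.
rewrite [LHS]deriveE// diff_comp//= diff1E//= derive1E [in RHS]mulrC.
by rewrite -deriveE.
Qed.

Lemma deriveM_scalar (K : numFieldType) (V : normedModType K) (f g : V -> K)
    (z v : V) : derivable f z v -> derivable g z v ->
  'D_v (f * g) z = f z * 'D_v g z + g z * 'D_v f z.
Proof. by move=> df dg; rewrite deriveM. Qed.

(** * The function [log (1 + L)] and its radial derivative *)

Section InnerLog.
Variables (R : realType) (d : nat).
Local Notation C := R[i].
Local Notation nc := (@Normc.normc R).

Lemma radial_deriv_diff (f : 'rV[C]_d -> C) (z : 'rV[C]_d) :
  differentiable f z -> radial_deriv f z = 'D_z f z.
Proof. exact: (@sum_derive_delta C d f z). Qed.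

Lemma derive_comp_complex (f : C -> C) (g : 'rV[C]_d -> C) (z v : 'rV[C]_d)
    (df : C) : differentiable g z -> is_derive (g z) 1 f df ->
  differentiable (f \o g) z /\ 'D_v (f \o g) z = df * 'D_v g z.
Proof.
move=> dg [ff <-].
have dff : differentiable f (g z) by exact/derivable1_diffP.
by split; [exact: differentiable_comp|exact: (@derive_comp_scalar C _ f g)].
Qed.

Lemma is_derive_principal_log_onep (w : C) : 0 <= complex.Re w ->
  is_derive w 1 (fun x : C => principal_log (1 + x)) (1 + w)^-1.
Proof.
move=> w0.
have w1 : 0 < complex.Re (1 + w) by case: w w0 => a b /=; lra.
have := is_derive_principal_log w1; move=> /is_derive_normcP H.
by apply/is_derive_normcP => e /H[r r0 hr]; exists r => // h /hr; rewrite addrA.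
Qed.

Variables (p : mpoly.mpoly d C) (n : nat) (L : 'rV[C]_d -> C).
Hypothesis p_neq0 : forall z : 'rV[C]_d, unit_ball z -> cpoly_eval p z <> 0.
Hypothesis n_deg : (total_degree p <= n)%N.
Hypothesis L_log : is_analytic_log
  (fun z => 2 ^+ n * cpoly_eval p 0 / cpoly_eval p z) L.
Local Notation F := (fun z => principal_log (1 + L z)).

Lemma slice_neq0 (z : 'rV[C]_d) (w : C) : sqnormC z <= 1 -> nc w < 1 ->
  (slice p z).[w] != 0.
Proof.
by move=> z1 w1; rewrite horner_slice; apply/eqP/p_neq0/unit_ballZ.
Qed.

(** Taking moduli in [cexp (L z) = 2 ^ n p 0 / p z] gives [expR (Re (L z))] on the left. *)
Lemma Re_analytic_log (z : 'rV[C]_d) : unit_ball z ->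
  complex.Re (L z) =
  ln (2 ^+ n * nc (cpoly_eval p 0) / nc (cpoly_eval p z)).
Proof.
case: L_log => _ Le zb.
have := congr1 nc (Le _ zb).
rewrite normc_cexp !Normc.normcM Normc.normcV normcX.
have -> : nc 2 = 2.
  have -> : (2 : C) = (2 : R)%:C by rewrite rmorph_nat.
  by rewrite normc_real ger0_norm.
by move=> <-; rewrite expRK.
Qed.

(** This keeps [1 + L] in the right half-plane, where the principal logarithm is differentiable. The
    bound comes from a slice through [z], whose roots lie outside the open disc. *)
Lemma Re_analytic_log_ge0 (z : 'rV[C]_d) : unit_ball z -> 0 <= complex.Re (L z).
Proof.
move=> zb; rewrite Re_analytic_log//.
have [l [z' [l1 z'1 zE]]] := unit_ball_scaled zb.
have sz : (size (slice p z') <= n.+1)%N.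
  by rewrite (leq_trans (size_slice _ _)).
have [s _ [_ /(_ _ l1)[+ _ _]]] :=
  roots_logderiv_bound sz (fun w => @slice_neq0 z' w z'1).
by rewrite !horner_slice scale0r -zE.
Qed.

Lemma differentiable_inner_log (z : 'rV[C]_d) : unit_ball z ->
  differentiable F z.
Proof.
move=> zb; have [dL _] := L_log.
exact: (derive_comp_complex 0 (dL z zb)
  (is_derive_principal_log_onep (Re_analytic_log_ge0 zb))).1.
Qed.

(** The product [p exp L] is constant on the ball; its derivative along [z] is
    [exp L (p D_z L + R p)], and the exponential does not vanish. *)
Lemma derive_analytic_log (z : 'rV[C]_d) : unit_ball z ->
  'D_z L z = - euler p z / cpoly_eval p z.
Proof.
move=> zb; have [dL Le] := L_log.
have pz0 : cpoly_eval p z != 0 by apply/eqP/p_neq0.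
have [dcL DcL] := derive_comp_complex z (dL z zb) (is_derive_cexp (L z)).
have [dp Dp] := is_derive_cpoly_eval p z.
have E : 'D_z (@cpoly_eval R d p * (@cexp R \o L)) z = 0.
  rewrite -(derive_cst (2 ^+ n * cpoly_eval p 0 : C) z z).
  apply: near_eq_derive.
  have : \forall v \near z, unit_ball v.
    by apply: open_nbhs_nbhs; split=> //; exact: open_unit_ball.
  apply: filterS => v vb /=; rewrite fctE /= Le// mulrC divfK//.
  exact/eqP/p_neq0.
have dcLz := @diff_derivable _ _ _ _ _ z dcL.
move: E; rewrite (@deriveM_scalar C _ _ _ z z dp dcLz) DcL Dp /= mulrCA.
rewrite -mulrDr => /eqP.
rewrite mulf_eq0 (negbTE (cexp_neq0 _)) /= => /eqP E.
apply: (mulfI pz0); rewrite mulrCA divff// mulr1.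
by apply/eqP; rewrite -subr_eq0 opprK E.
Qed.

Lemma radial_deriv_inner_log (z : 'rV[C]_d) : unit_ball z ->
  radial_deriv F z = - euler p z / (cpoly_eval p z * (1 + L z)).
Proof.
move=> zb; have [dL _] := L_log.
rewrite radial_deriv_diff; last exact: differentiable_inner_log.
have [_ ->] := derive_comp_complex z (dL z zb)
  (is_derive_principal_log_onep (Re_analytic_log_ge0 zb)).
by rewrite derive_analytic_log// mulrC invfM mulrA.
Qed.

Lemma onep_analytic_log_neq0 (z : 'rV[C]_d) : unit_ball z -> 1 + L z != 0.
Proof.
move=> /Re_analytic_log_ge0; apply: contraTneq => E.
have := congr1 (@complex.Re R) E; case: (L z) => a b /=; lra.
Qed.

(** Continuity is read off the explicit quotient, valid near [z]; it gives the measurability of the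
    radial derivative. *)
Lemma cvg_radial_deriv_inner_log (z : 'rV[C]_d) : unit_ball z ->
  radial_deriv F v @[v --> z] --> radial_deriv F z.
Proof.
move=> zb; have [dL _] := L_log.
rewrite radial_deriv_inner_log//.
have nb : \forall v \near z, unit_ball v.
  by apply: open_nbhs_nbhs; split=> //; exact: open_unit_ball.
have E : {near z, (fun v => - euler p v / (cpoly_eval p v * (1 + L v))) =1
                  (radial_deriv F : 'rV[C]_d -> C)}.
  by apply: filterS nb => v vb; rewrite radial_deriv_inner_log.
apply: cvg_trans (near_eq_cvg E) _.
apply: (@cvg_quotient _ _ (nbhs z) (nbhs_filter z)).
- exact: cvg_euler.
- exact: cvg_cpoly_eval.
- exact: (differentiable_continuous (dL z zb)).
- exact/eqP/p_neq0.
- exact: onep_analytic_log_neq0.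
Qed.

End InnerLog.

(** * One-dimensional integrals of the logarithmic kernels *)

Section LogIntegrals.
Variable R : realType.
Implicit Types (r t x y : R).
Local Notation mu := (@lebesgue_measure R).

(** Bounds the integral over the arc as a primitive, and is then integrated over the radius: it is
    the derivative of [(4 - ln y)^-1], which stays bounded near 0. *)
Definition log_prim y := (y * (4 - ln y) ^+ 2)^-1.

(* [log_kernel = - 2 log_prim'], and it dominates [1 / (y (4 - ln y)) ^ 2] on
   [(0, 1]]. *)
Definition log_kernel y := 2 * (2 - ln y) / (y ^+ 2 * (4 - ln y) ^+ 3).

Lemma four_sub_ln_ge y : 0 < y -> y <= 1 -> 4 <= 4 - ln y.
Proof. by move=> y0 y1; have : ln y <= 0 by [rewrite ln_le0]; lra. Qed.

Lemma log_prim_ge0 y : 0 <= y -> 0 <= log_prim y.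
Proof. by move=> y0; rewrite /log_prim invr_ge0 mulr_ge0 ?sqr_ge0. Qed.

(** The quotient of the two sides is [2 (2 - ln y) / (4 - ln y)], at least 1 because
    [4 - 2 ln y >= 4 - ln y] on [(0, 1]]; this explains the constant 4. *)
Lemma le_log_kernel y : 0 < y -> y <= 1 ->
  ((y * (4 - ln y))^-1) ^+ 2 <= log_kernel y.
Proof.
move=> y0 y1; have l4 := four_sub_ln_ge y0 y1.
have -> : log_kernel y =
    ((y * (4 - ln y))^-1) ^+ 2 * (2 * (2 - ln y) / (4 - ln y)).
  by rewrite /log_kernel; field; rewrite !gt_eqF//; lra.
rewrite ler_peMr ?sqr_ge0// ler_pdivlMr; lra.
Qed.

Lemma log_kernel_ge0 y : 0 < y -> y <= 1 -> 0 <= log_kernel y.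
Proof.
by move=> y0 y1; rewrite (le_trans _ (le_log_kernel y0 y1))// sqr_ge0.
Qed.

Lemma cvg_four_sub_ln y : 0 < y -> 4 - ln x @[x --> y] --> 4 - ln y.
Proof.
move=> y0; apply: cvgB; first exact: cvg_cst.
exact: continuous_ln.
Qed.

Lemma cvg_log_kernel y : 0 < y -> y <= 1 ->
  log_kernel x @[x --> y] --> log_kernel y.
Proof.
move=> y0 y1; have l4 := four_sub_ln_ge y0 y1.
have cl := cvg_four_sub_ln y0.
apply: cvgM.
  apply: cvgM; first exact: cvg_cst.
  by apply: cvgB; [exact: cvg_cst|exact: continuous_ln].
apply: cvgV; first by rewrite mulf_neq0 ?expf_neq0 ?gt_eqF//; lra.
apply: cvgM; first exact: exprn_continuous.
by apply: (@continuous_cvg _ _ _ _ _ _ (fun x : R => x ^+ 3)) => //;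
  exact: exprn_continuous.
Qed.

Lemma cvg_log_prim y : 0 < y -> y <= 1 ->
  log_prim x @[x --> y] --> log_prim y.
Proof.
move=> y0 y1; have l4 := four_sub_ln_ge y0 y1.
have cl := cvg_four_sub_ln y0.
apply: cvgV; first by rewrite mulf_neq0 ?expf_neq0 ?gt_eqF//; lra.
apply: cvgM; first exact: cvg_id.
by apply: (@continuous_cvg _ _ _ _ _ _ (fun x : R => x ^+ 2)) => //;
  exact: exprn_continuous.
Qed.

Lemma is_derive_four_sub_ln y : 0 < y ->
  is_derive y 1 (fun x => 4 - ln x) (- y^-1).
Proof.
move=> y0; have ? := is_derive1_ln y0.
have -> : (fun x : R => 4 - ln x) = cst 4 - (@ln R) by [].
by apply: is_derive_eq; rewrite sub0r.
Qed.

Lemma is_derive_log_prim y : 0 < y -> y <= 1 ->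
  is_derive y 1 log_prim (- log_kernel y / 2).
Proof.
move=> y0 y1; have l4 := four_sub_ln_ge y0 y1.
have dl := is_derive_four_sub_ln y0.
have d0 : is_derive y 1 (id * (fun x => 4 - ln x) ^+ 2 : R -> R)
    ((4 - ln y) * (2 - ln y)).
  apply: is_derive_eq.
  rewrite /GRing.scale /= !fctE /= expr1 /=; field; rewrite gt_eqF//; lra.
have n0 : (id * (fun x => 4 - ln x) ^+ 2 : R -> R) y != 0.
  by rewrite !fctE /= mulf_neq0 ?expf_neq0 ?gt_eqF//; lra.
apply: is_derive_eq; first exact: (is_deriveV n0 d0).
rewrite /log_kernel /GRing.scale /= !fctE /=; field; rewrite !gt_eqF//; lra.
Qed.

Lemma is_derive_inv_four_sub_ln y : 0 < y -> y <= 1 ->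
  is_derive y 1 (fun x => (4 - ln x)^-1) (log_prim y).
Proof.
move=> y0 y1; have l4 := four_sub_ln_ge y0 y1.
have dl := is_derive_four_sub_ln y0.
have n0 : (fun x => 4 - ln x) y != 0 by rewrite gt_eqF//; lra.
have [h1 h2] := is_deriveV (f := fun x => 4 - ln x) n0 dl.
apply: DeriveDef; first exact: h1.
apply: (etrans h2).
rewrite /log_prim /GRing.scale /= ; field; rewrite !gt_eqF//; lra.
Qed.

Lemma is_derive_affine (a b x : R) : is_derive x 1 (fun x => a + b * x) b.
Proof.
have := is_deriveD (is_derive_cst a x 1) (is_deriveZ b (is_derive_id x 1)).
by rewrite add0r /GRing.scale /= mulr1.
Qed.

Lemma FTC2_closed (f F : R -> R) (a b : R) : a < b ->
  (forall x, a <= x <= b -> is_derive x 1 F (f x)) ->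
  (forall x, a <= x <= b -> f y @[y --> x] --> f x) ->
  (\int[mu]_(x in `[a, b]) (f x)%:E = (F b)%:E - (F a)%:E)%E.
Proof.
move=> ab dF cf.
have cF x : a <= x <= b -> F y @[y --> x] --> F x.
  move=> /dF[dFx _]; exact/differentiable_continuous/derivable1_diffP.
apply: continuous_FTC2 => //.
- apply: continuous_in_subspaceT => x; rewrite inE/= in_itv/= => xab.
  exact: cf.
- split.
  + move=> x; rewrite in_itv/= => /andP[ax xb].
    have axb : a <= x <= b by rewrite !ltW.
    by have [] := dF x axb.
  + by apply: cvg_at_right_filter; apply: cF; rewrite lexx ltW.
  + by apply: cvg_at_left_filter; apply: cF; rewrite lexx ltW.
- move=> x; rewrite in_itv/= => /andP[ax xb]; rewrite derive1E.
  have axb : a <= x <= b by rewrite !ltW.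
  by have [_ ->] := dF x axb.
Qed.

(** The slope [r] may have either sign, as the two halves of [|t - t0|] require. Keeping it as a
    factor of the integrand avoids a division by [r]. *)
Lemma integral_log_kernel_affine (k c r a b : R) : a < b ->
  (forall t, a <= t <= b -> 0 < c + r * t <= 1) ->
  (\int[mu]_(t in `[a, b]) (k * (r * log_kernel (c + r * t)))%:E =
   (2 * k * (log_prim (c + r * a) - log_prim (c + r * b)))%:E)%E.
Proof.
move=> ab cr.
pose F t := - 2 * k * log_prim (c + r * t).
have dF t : a <= t <= b ->
    is_derive t 1 F (k * (r * log_kernel (c + r * t))).
  move=> /cr/andP[t0 t1].
  have d1 := is_derive_affine c r t; have d2 := is_derive_log_prim t0 t1.
  have d3 := @is_derive1_comp R log_prim (fun t => c + r * t) t _ _ d2 d1.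
  apply: (is_derive_eq (is_deriveZ (- 2 * k) d3)).
  by rewrite /GRing.scale /=; field.
rewrite (FTC2_closed ab dF); first by rewrite /F -EFinB; congr EFin; ring.
move=> t /cr/andP[t0 t1]; apply: cvgM; first exact: cvg_cst.
apply: cvgM; first exact: cvg_cst.
apply: (@continuous_cvg _ _ _ _ _ _ log_kernel); first exact: cvg_log_kernel.
apply: cvgD; first exact: cvg_cst.
by apply: cvgM; [exact: cvg_cst|exact: cvg_id].
Qed.

Section AbsKernel.
Variables (r t0 : R).
Hypotheses (r01 : 0 <= r < 1).

(** The radius 3/2 leaves room around [[t0 - 1, t0 + 1]], so that the kernel is continuous on an
    open interval containing it. *)
Lemma abs_arg_bounds t : t0 - 3 / 2 <= t <= t0 + 3 / 2 ->
  0 < (1 - r + r * `|t - t0|) / 2 <= 1.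
Proof.
have [r0 r1] := andP r01.
move=> t1; have : `|t - t0| <= 3 / 2 by rewrite ler_norml; lra.
move: `|t - t0| (normr_ge0 (t - t0)) => s s0 s1.
by apply/andP; split; nra.
Qed.

Lemma measurable_log_kernel_abs (D : set R) :
  D `<=` `[t0 - 1, t0 + 1] ->
  measurable_fun (D : set (measurableTypeR R))
    (fun t => r * log_kernel ((1 - r + r * `|t - t0|) / 2)).
Proof.
move=> Dsub.
apply: (@measurable_funS _ _ _ _ `]t0 - 3 / 2, t0 + 3 / 2[%classic) => //.
  move=> t /Dsub /=; rewrite !in_itv/=; lra.
apply: open_continuous_measurable_fun; first exact: interval_open.
move=> t; rewrite inE/= in_itv/= => t1.
have /abs_arg_bounds/andP[y0 y1] : t0 - 3 / 2 <= t <= t0 + 3 / 2 by lra.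
apply: cvgM; first exact: cvg_cst.
apply: (@continuous_cvg _ _ _ _ _ _ log_kernel); first exact: cvg_log_kernel.
apply: cvgM; last exact: cvg_cst.
apply: cvgD; first exact: cvg_cst.
apply: cvgM; first exact: cvg_cst.
by apply: cvg_norm; apply: cvgB; [exact: cvg_id|exact: cvg_cst].
Qed.

(** Enlarging [[0, 1]] to [[t0 - 1, t0 + 1]] makes the bound independent of [t0]: on each half the
    argument is affine, and the integral is [4 (log_prim ((1 - r) / 2) - log_prim (1 / 2))]. *)
Lemma integral_log_kernel_abs : 0 <= t0 <= 1 ->
  (\int[mu]_(t in `[0%R, 1%R])
     (r * log_kernel ((1 - r + r * `|t - t0|) / 2))%:E <=
   (8 * log_prim ((1 - r) / 2))%:E)%E.
Proof.
move=> /andP[t00 t01]; have [r0 r1] := andP r01.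
pose f t := (r * log_kernel ((1 - r + r * `|t - t0|) / 2))%:E.
have mf (D : set R) : D `<=` `[t0 - 1, t0 + 1] ->
    measurable_fun (D : set (measurableTypeR R)) f.
  by move=> /measurable_log_kernel_abs/measurable_EFinP.
have f0 t : t0 - 1 <= t <= t0 + 1 -> (0 <= f t)%E.
  move=> ht; have /abs_arg_bounds/andP[y0 y1] :
    t0 - 3 / 2 <= t <= t0 + 3 / 2 by lra.
  by rewrite lee_fin mulr_ge0// log_kernel_ge0.
have lp0 : 0 <= log_prim (1 / 2 : R) by rewrite log_prim_ge0// divr_ge0.
have Ir : (\int[mu]_(t in `[t0, (t0 + 1)%R]) f t <=
           (4 * log_prim ((1 - r) / 2))%:E)%E.
  (* The argument of the kernel has slope [r / 2], hence the factor 2; on the left half the slope is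
     [- (r / 2)] and the factor [- 2]. *)
  have -> : (\int[mu]_(t in `[t0, (t0 + 1)%R]) f t =
     \int[mu]_(t in `[t0, (t0 + 1)%R])
     (2 * (r / 2 * log_kernel ((1 - r) / 2 - r / 2 * t0 + r / 2 * t)))%:E)%E.
    apply: eq_integral => t; rewrite inE/= in_itv/= => /andP[t1 t2].
    rewrite /f ger0_norm ?subr_ge0//; congr EFin.
    by rewrite mulrA; congr (_ * log_kernel _); field.
  rewrite integral_log_kernel_affine; last 2 first.
  - by rewrite ltrDl.
  - by move=> t /andP[t1 t2]; apply/andP; split; nra.
  rewrite lee_fin.
  have -> : (1 - r) / 2 - r / 2 * t0 + r / 2 * t0 = (1 - r) / 2 by ring.
  have -> : (1 - r) / 2 - r / 2 * t0 + r / 2 * (t0 + 1) = 1 / 2 by field.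
  lra.
have Il : (\int[mu]_(t in `[(t0 - 1)%R, t0]) f t <=
           (4 * log_prim ((1 - r) / 2))%:E)%E.
  have -> : (\int[mu]_(t in `[(t0 - 1)%R, t0]) f t =
     \int[mu]_(t in `[(t0 - 1)%R, t0])
     (- 2 * (- (r / 2) *
        log_kernel ((1 - r) / 2 + r / 2 * t0 + - (r / 2) * t)))%:E)%E.
    apply: eq_integral => t; rewrite inE/= in_itv/= => /andP[t1 t2].
    rewrite /f ler0_norm ?subr_le0//; congr EFin.
    by rewrite mulrA; congr (_ * log_kernel _); field.
  rewrite integral_log_kernel_affine; last 2 first.
  - by rewrite ltrBlDr ltrDl.
  - by move=> t /andP[t1 t2]; apply/andP; split; nra.
  rewrite lee_fin.
  have -> : (1 - r) / 2 + r / 2 * t0 + - (r / 2) * t0 = (1 - r) / 2 by ring.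
  have -> : (1 - r) / 2 + r / 2 * t0 + - (r / 2) * (t0 - 1) = 1 / 2 by field.
  lra.
have U : `[t0 - 1, t0]%classic `|` `]t0, t0 + 1]%classic =
    `[t0 - 1, t0 + 1]%classic.
  by rewrite -itv_bndbnd_setU// bnd_simp; lra.
apply: (@le_trans _ _ (\int[mu]_(t in `[(t0 - 1)%R, (t0 + 1)%R]) f t)%E).
  apply: ge0_subset_integral => //.
  - exact: mf.
  - by move=> t /=; rewrite !in_itv/=; lra.
rewrite -U ge0_integral_setU//=; last 3 first.
- by rewrite U; exact: mf.
- by move=> t []; rewrite in_itv/= => ht; apply: f0; lra.
- apply/disj_setPS => t /= [] ; rewrite !in_itv/=; lra.
have -> : 8 * log_prim ((1 - r) / 2) =
    4 * log_prim ((1 - r) / 2) + 4 * log_prim ((1 - r) / 2).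
  by ring.
rewrite EFinD; apply: leeD => //; apply: le_trans Ir.
apply: ge0_subset_integral => //.
- by apply: mf => t /=; rewrite !in_itv/=; lra.
- by move=> t tin; apply: f0; move: tin; rewrite /= in_itv/=; lra.
- by move=> t /=; rewrite !in_itv/= => /andP[? ?]; apply/andP; split; lra.
Qed.

End AbsKernel.

Lemma measurable_log_prim (D : set R) : D `<=` `[0, 1[%classic ->
  measurable_fun (D : set (measurableTypeR R))
    (fun r => log_prim ((1 - r) / 2)).
Proof.
move=> D01.
apply: (@measurable_funS _ _ _ _
  (`](-1), 1[%classic : set (measurableTypeR R))) => //.
  move=> t /D01 /=; rewrite !in_itv/=; lra.
apply: open_continuous_measurable_fun; first exact: interval_open.
move=> x; rewrite inE/= in_itv/= => hx.
apply: (@continuous_cvg _ _ _ _ _ _ log_prim).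
  by apply: cvg_log_prim; lra.
apply: cvgM; last exact: cvg_cst.
by apply: cvgB; [exact: cvg_cst|exact: cvg_id].
Qed.

(** The integrand is singular at 1, so the fundamental theorem is applied on intervals exhausting
    [[0, 1[], followed by monotone convergence. *)
Lemma integral_log_prim_le1 :
  (\int[mu]_(r in `[0%R, 1%R[) (log_prim ((1 - r) / 2))%:E <= 1)%E.
Proof.
(* With [k.+2] the right endpoint is at least 1/2, so that no interval is degenerate. *)
pose F (k : nat) : set R := `[0, 1 - k.+2%:R^-1]%classic.
have E : `[0, 1[%classic = \bigcup_k F k.
  apply/seteqP; split => x /=; rewrite ?in_itv/=.
    move=> /andP[x0 x1]; exists (Num.truncn (1 - x)^-1) => //=.
    rewrite /F /= in_itv/= x0/= lerBrDr addrC -lerBrDr.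
    rewrite invf_ple ?posrE ?subr_gt0// (le_trans (ltW (truncnS_gt _)))//.
    by rewrite ler_nat.
  move=> [k _] /=; rewrite /F /= in_itv/= => /andP[-> h]/=.
  have : 0 < k.+2%:R^-1 :> R by rewrite invr_gt0 ltr0n.
  by move: h; move: (k.+2%:R^-1) => e; lra.
have k2 (k : nat) : 0 < (k.+2%:R^-1 : R) <= 1 / 2.
  by rewrite invr_gt0 ltr0n/= div1r lef_pV2 ?posrE// ler_nat.
have yb k x : F k x -> 0 < (1 - x) / 2 <= 1.
  by rewrite /F /= in_itv/=; have := k2 k; move: (k.+2%:R^-1) => e; lra.
have cvg_lp k x : F k x ->
    log_prim ((1 - y) / 2) @[y --> x] --> log_prim ((1 - x) / 2).
  move=> /yb/andP[y0 y1].
  apply: (@continuous_cvg _ _ _ _ _ _ log_prim); first exact: cvg_log_prim.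
  apply: cvgM; last exact: cvg_cst.
  by apply: cvgB; [exact: cvg_cst|exact: cvg_id].
rewrite E.
have cv : (\int[mu]_(x in F i) (log_prim ((1 - x) / 2))%:E @[i --> \oo] -->
    \int[mu]_(x in \bigcup_i F i) (log_prim ((1 - x) / 2))%:E)%E.
  apply: ge0_nondecreasing_set_cvg_integral.
  - apply/nondecreasing_seqP => k; rewrite subsetEset => x /=.
    rewrite /F /= !in_itv/= => /andP[-> h]/=; apply: (le_trans h).
    by rewrite lerB// lef_pV2 ?posrE ?ltr0n// ler_nat.
  - by move=> k; exact: measurable_itv.
  - move=> k; apply/measurable_EFinP; apply: measurable_log_prim => x.
    rewrite /F /= !in_itv/=; have := k2 k; move: (k.+2%:R^-1) => e; lra.
  - by move=> k x /yb/andP[y0 y1]; rewrite lee_fin log_prim_ge0// ltW.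
apply: (cvge_to_le cv); near=> k.
(* The factor [- 2] compensates the inner derivative [- 1 / 2]. As [4 - ln y >= 4], the increment of
   [G] is at most 1/2. *)
pose G x : R := - 2 * (4 - ln ((1 - x) / 2))^-1.
have dG x : 0 <= x <= 1 - k.+2%:R^-1 ->
    is_derive x 1 G (log_prim ((1 - x) / 2)).
  move=> xF; have /yb/andP[y0 y1] : F k x by rewrite /F /= in_itv.
  have d1 : is_derive x 1 (fun x => 1 / 2 + - (1 / 2) * x) (- (1 / 2)) :=
    is_derive_affine (1 / 2) (- (1 / 2)) x.
  have d2 := is_derive_inv_four_sub_ln y0 y1.
  have E1 : (fun x : R => 1 / 2 + - (1 / 2) * x) = (fun x => (1 - x) / 2).
    by apply/funext => y; field.
  rewrite E1 in d1.
  have d3 := @is_derive1_comp R _ (fun x => (1 - x) / 2) x _ _ d2 d1.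
  apply: (is_derive_eq (is_deriveZ (- 2) d3)).
  by rewrite /GRing.scale /=; field.
have k2k := k2 k.
rewrite (FTC2_closed _ dG); last 2 first.
- by move: (k.+2%:R^-1) k2k => e; lra.
- by move=> x xF; apply: (cvg_lp k); rewrite /F /= in_itv.
rewrite -EFinB lee_fin /G subr0.
have -> : (1 - (1 - k.+2%:R^-1)) / 2 = k.+2%:R^-1 / 2 :> R by ring.
have h1 : 4 <= 4 - ln (1 / 2 : R) by rewrite four_sub_ln_ge//; lra.
have h2 : 4 <= 4 - ln (k.+2%:R^-1 / 2 : R).
  by rewrite four_sub_ln_ge//; move: (k.+2%:R^-1) k2k => e; lra.
have i1 : (4 - ln (1 / 2 : R))^-1 <= 1 / 4.
  by rewrite [leRHS]div1r lef_pV2 ?posrE//; lra.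
have i2 : 0 <= (4 - ln (k.+2%:R^-1 / 2 : R))^-1 by rewrite invr_ge0; lra.
by lra.
Unshelve. all: by end_near. Qed.

End LogIntegrals.

(** * Pointwise bound of the radial derivative along an arc *)

Section RayEstimate.
Variables (R : realType) (d : nat).
Local Notation C := R[i].
Local Notation nc := (@Normc.normc R).

Definition circle_pt (t : R) : C := Num.sqrt (1 - t ^+ 2) +i* t.

Lemma normc_circle_pt t : 0 <= t <= 1 -> nc (circle_pt t) = 1.
Proof.
move=> /andP[t0 t1]; rewrite /circle_pt /= sqr_sqrtr ?subrK ?sqrtr1//.
by rewrite subr_ge0 expr_le1.
Qed.

(** Projection to [[0, 1]] does not increase distances to points of [[0, 1]]; it brings the centre
    of each kernel into the arc. *)
Lemma exists_clamp (x : R) :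
  exists2 y : R, 0 <= y <= 1 & forall t, 0 <= t <= 1 -> `|t - y| <= `|t - x|.
Proof.
have [x0|x0] := leP x 0.
  exists 0; first by rewrite lexx ler01.
  by move=> t ht; rewrite !ger0_norm; lra.
have [x1|x1] := leP 1 x.
  exists 1; first by rewrite lexx ler01.
  by move=> t ht; rewrite !ler0_norm; lra.
by exists x => //; rewrite !ltW.
Qed.

Lemma Im_real_mul_circle (r t : R) (b : C) :
  complex.Im (r%:C * circle_pt t - b) = r * t - complex.Im b.
Proof. by case: b => b1 b2 /=; ring. Qed.

Variables (p : mpoly.mpoly d C) (n : nat) (L : 'rV[C]_d -> C).
Hypothesis p_neq0 : forall z : 'rV[C]_d, unit_ball z -> cpoly_eval p z <> 0.
Hypothesis n_deg : (total_degree p <= n)%N.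
Hypothesis L_log : is_analytic_log
  (fun z => 2 ^+ n * cpoly_eval p 0 / cpoly_eval p z) L.
Local Notation F := (fun z => principal_log (1 + L z)).

(* Only the imaginary part of [r circle_pt t - b], which is affine in [t], is
   needed to keep [r circle_pt t] away from a root [b]. *)
Lemma root_distance_bound (r t t0 : R) (b : C) : 0 <= r < 1 -> 0 <= t <= 1 ->
  1 <= nc b -> 0 <= t0 <= 1 ->
  r * `|t - t0| <= `|r * t - complex.Im b| ->
  0 < (1 - r + r * `|t - t0|) / 2 <= 1 /\
  (1 - r + r * `|t - t0|) / 2 <= nc (r%:C * circle_pt t - b).
Proof.
move=> /andP[r0 r1] t01 b1 t001 hb; split.
  have : `|t - t0| <= 1 by rewrite ler_norml; lra.
  move: `|t - t0| (normr_ge0 (t - t0)) => s s0 s1.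
  by apply/andP; split; nra.
have := normc_ge_absIm (r%:C * circle_pt t - b).
rewrite Im_real_mul_circle.
have := normcB_ge b (r%:C * circle_pt t).
rewrite Normc.normcM normc_circle_pt// mulr1 normc_real ger0_norm//.
lra.
Qed.

(** The 16 is the square of the factor 4 in the bound for each root, and [n] comes from
    Cauchy-Schwarz. Of the two factors [r] from [nc l ^ 2], one stays inside the sum, where the
    integration in [t] needs it. *)
Lemma ray_bound (z : 'rV[C]_d) (r : R) : sqnormC z <= 1 -> 0 <= r < 1 ->
  exists s : seq R, [/\ (size s <= n)%N, forall t0, t0 \in s -> 0 <= t0 <= 1 &
  forall t, 0 <= t <= 1 ->
    nc (radial_deriv F ((r%:C * circle_pt t) *: z)) ^+ 2 <=
    16 * n%:R * r *
    \sum_(t0 <- s) r * log_kernel ((1 - r + r * `|t - t0|) / 2)].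
Proof.
move=> z1 r01; have [r0 r1] := andP r01.
have sz : (size (slice p z) <= n.+1)%N by rewrite (leq_trans (size_slice _ _)).
have [s ss [sb sl]] :=
  roots_logderiv_bound sz (fun w => @slice_neq0 _ _ _ p_neq0 z w z1).
(* The centre attached to a root is [Im b / r] projected to [[0, 1]]; for [r = 0] the left-hand side
   vanishes. *)
have cl (b : C) : {y : R | 0 <= y <= 1 &
    forall t, 0 <= t <= 1 -> r * `|t - y| <= `|r * t - complex.Im b|}.
  apply: cid2; have [y y01 hy] := exists_clamp (complex.Im b / r).
  exists y => // t t01; have [->|rn0] := eqVneq r 0.
    by rewrite mul0r.
  apply: le_trans (ler_wpM2l r0 (hy t t01)) _.
  rewrite -{1}(ger0_norm r0) -normrM mulrBr mulrCA divff// mulr1.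
  exact: lexx.
pose T b := s2val (cl b).
exists (map T s); split.
- by rewrite size_map.
- by move=> t0 /mapP[b _ ->]; rewrite /T; case: (cl b).
move=> t t01.
set l := r%:C * circle_pt t.
have nl : nc l = r.
  by rewrite Normc.normcM normc_circle_pt// mulr1 normc_real ger0_norm.
have l1 : nc l < 1 by rewrite nl.
have lzb : unit_ball (l *: z) by exact: unit_ballZ.
have [La dq bnd] := sl _ l1.
rewrite !horner_slice scale0r in La bnd.
rewrite -(Re_analytic_log L_log lzb) in La bnd.
have La1 : 1 + complex.Re (L (l *: z)) <= nc (1 + L (l *: z)).
  apply: le_trans (normc_ge_absRe _); rewrite (le_trans _ (ler_norm _))//.
  by case: (L _).
have La0 : 0 < 1 + complex.Re (L (l *: z)) by lra.
set La' := 1 + complex.Re (L (l *: z)) in La1 La0.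
have -> : radial_deriv F (l *: z) =
    - (l * ((slice p z)^`().[l] / (slice p z).[l])) / (1 + L (l *: z)).
  rewrite (radial_deriv_inner_log p_neq0 n_deg L_log)//.
  by rewrite -horner_deriv_slice horner_slice invfM !mulrA mulNr.
pose y (b : C) := (1 - r + r * `|t - T b|) / 2.
have yP b : b \in s -> 0 < y b <= 1 /\ y b <= nc (l - b).
  move=> bs; apply: root_distance_bound => //; first exact: sb.
    by rewrite /T; case: (cl b).
  by rewrite /T; case: (cl b) => ? ? /=; apply.
(* The growth of [1 + L] is used here: [La'] dominates the logarithm [1 + ln (2 |b| / |l - b|)] of
   every single root. *)
have gb b : b \in s ->
    (nc (l - b))^-1 / La' <= 4 * (y b * (4 - ln (y b)))^-1.
  move=> bs; have [/andP[y0 y1] yx] := yP b bs.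
  have x0 : 0 < nc (l - b) by exact: lt_le_trans yx.
  have [x2 lnb] := bnd b bs.
  have l4 := four_sub_ln_ge y0 y1.
  have G0 : 0 < y b * (4 - ln (y b)) by rewrite mulr_gt0//; lra.
  have H := le_mul_four_subr_ln y0 y1 yx (sb b bs) x2.
  have xL : nc (l - b) * (1 + ln (2 * nc b / nc (l - b))) <= nc (l - b) * La'.
    by rewrite ler_wpM2l ?normc_ge0// /La'; lra.
  have GL : y b * (4 - ln (y b)) / 4 <= nc (l - b) * La' by lra.
  have -> : 4 * (y b * (4 - ln (y b)))^-1 = (y b * (4 - ln (y b)) / 4)^-1.
    by rewrite invf_div.
  by rewrite -invfM lef_pV2 ?posrE// ?(divr_gt0 G0)// mulr_gt0.
set RF := - (l * _) / _.
have nRF : nc RF <= r * \sum_(b <- s) 4 * (y b * (4 - ln (y b)))^-1.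
  rewrite /RF Normc.normcM normcN Normc.normcM nl dq Normc.normcV -mulrA.
  apply: ler_wpM2l => //.
  apply: (@le_trans _ _ ((\sum_(b <- s) (nc (l - b))^-1) / La')).
    apply: ler_pM; rewrite ?normc_ge0 ?invr_ge0 ?normc_ge0//.
      apply: le_trans (normc_sum_le _ _) _.
      by apply: ler_sum => b _; rewrite Normc.normcV.
    by rewrite lef_pV2 ?posrE// (lt_le_trans La0).
  rewrite mulr_suml big_seq [leRHS]big_seq; apply: ler_sum => b bs.
  exact: gb.
have n0 := normc_ge0 RF.
apply: (@le_trans _ _ ((r * \sum_(b <- s) 4 * (y b * (4 - ln (y b)))^-1) ^+ 2)).
  by rewrite ler_pXn2r ?nnegrE// (le_trans n0).
rewrite -mulr_sumr big_map.
set S := \sum_(b <- s) (y b * _)^-1.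
have S2 : S ^+ 2 <= n%:R * \sum_(b <- s) log_kernel (y b).
  apply: le_trans (sqr_sum_le _ _) _.
  apply: ler_pM => //; first by rewrite sumr_ge0// => b _; exact: sqr_ge0.
    by rewrite ler_nat.
  rewrite big_seq [leRHS]big_seq; apply: ler_sum => b bs.
  by have [/andP[y0 y1] _] := yP b bs; exact: le_log_kernel.
rewrite -mulr_sumr.
have -> : (r * (4 * S)) ^+ 2 = 16 * r * r * S ^+ 2 by ring.
apply: le_trans (ler_wpM2l _ S2) _; first by rewrite !mulr_ge0.
by rewrite le_eqVlt; apply/orP; left; apply/eqP; ring.
Qed.

End RayEstimate.

(** * Integration over the sphere and over the radius *)

Section RadialIntegral.
Variables (R : realType) (d : nat).
Local Notation C := R[i].
Local Notation nc := (@Normc.normc R).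
Local Notation leb := (@lebesgue_measure R).

Lemma measurable_coord_Re (j : 'I_d) :
  measurable_fun setT (fun z : borelC R d => complex.Re ((z : 'rV[C]_d) 0 j)).
Proof.
apply: open_cvg_measurable_fun; first exact: openT.
move=> z _; apply: (@cvg_comp _ _ _ (fun v : 'rV[C]_d => v 0 j)
  (@complex.Re R) (nbhs z) (nbhs (z 0 j))); first exact: coord_continuous.
exact: continuous_Re.
Qed.

Lemma measurable_coord_Im (j : 'I_d) :
  measurable_fun setT (fun z : borelC R d => complex.Im ((z : 'rV[C]_d) 0 j)).
Proof.
apply: open_cvg_measurable_fun; first exact: openT.
move=> z _; apply: (@cvg_comp _ _ _ (fun v : 'rV[C]_d => v 0 j)
  (@complex.Im R) (nbhs z) (nbhs (z 0 j))); first exact: coord_continuous.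
exact: continuous_Im.
Qed.

Lemma measurable_scale_row (dd : measure_display) (T : measurableType dd)
    (f g : T -> R) (h : T -> 'rV[C]_d) :
  measurable_fun setT f -> measurable_fun setT g ->
  measurable_fun setT (h : T -> borelC R d) ->
  measurable_fun setT (fun x => (f x +i* g x) *: h x : borelC R d).
Proof.
move=> mf mg mh; apply: measurable_fun_row => j.
- have -> : (fun x => complex.Re (((f x +i* g x) *: h x) 0 j)) =
      (fun x => f x * complex.Re (h x 0 j) - g x * complex.Im (h x 0 j)).
    by apply/funext => x; rewrite mxE; case: (h x 0 j).
  apply: measurable_funB; apply: measurable_funM => //.
    exact: (measurableT_comp (measurable_coord_Re j) mh).
  exact: (measurableT_comp (measurable_coord_Im j) mh).
- have -> : (fun x => complex.Im (((f x +i* g x) *: h x) 0 j)) =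
      (fun x => f x * complex.Im (h x 0 j) + g x * complex.Re (h x 0 j)).
    by apply/funext => x; rewrite mxE; case: (h x 0 j).
  apply: measurable_funD; apply: measurable_funM => //.
    exact: (measurableT_comp (measurable_coord_Im j) mh).
  exact: (measurableT_comp (measurable_coord_Re j) mh).
Qed.

Lemma scalar_unitarymx (c : C) : nc c = 1 -> (c%:M : 'M[C]_d) \is unitarymx.
Proof.
move=> c1; apply/unitarymxP.
rewrite tr_scalar_mx map_scalar_mx -scalar_mxM; congr (_%:M).
by rewrite -normCK normcE c1 expr1n.
Qed.

Variable sigma : probability (borelC R d) R.
Hypothesis sigma_inv : is_normalized_rotation_invariant sigma.

Lemma measurable_unit_sphere : measurable (@unit_sphere R d : set (borelC R d)).
Proof.
have ms : measurable_fun setT (fun z : borelC R d => sqnormC (z : 'rV[C]_d)).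
  apply: open_cvg_measurable_fun; first exact: openT.
  by move=> z _; exact: cvg_sqnormC.
rewrite [X in measurable X](_ : _ = setT `&`
  (fun z : borelC R d => sqnormC (z : 'rV[C]_d)) @^-1` [set 1]).
  by apply: ms => //; exact: measurable_set1.
by rewrite setTI.
Qed.

(** Multiplication by [c] is the action of the unitary matrix [c%:M], so [sigma] equals its own
    image. *)
Lemma integral_sigma_rotate (c : C) (H : borelC R d -> \bar R) : nc c = 1 ->
  measurable_fun setT H -> (forall z, (0 <= H z)%E) ->
  (\int[sigma]_z H z = \int[sigma]_z H (c *: (z : 'rV[C]_d)))%E.
Proof.
move=> c1 mH H0.
pose phi (z : borelC R d) : borelC R d := (z : 'rV[C]_d) *m c%:M.
have phiE z : phi z = c *: (z : 'rV[C]_d) by rewrite /phi mul_mx_scalar.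
have mphi : measurable_fun setT phi.
  have -> : phi = (fun z : borelC R d =>
      (complex.Re c +i* complex.Im c) *: (z : 'rV[C]_d) : borelC R d).
    by apply/funext => z; rewrite phiE; case: (c).
  by apply: measurable_scale_row => //; exact: measurable_id.
transitivity (\int[pushforward sigma phi]_z H z)%E.
  apply: eq_measure_integral => A mA _.
  rewrite /pushforward; apply/esym/sigma_inv.2 => //.
  exact: scalar_unitarymx.
rewrite ge0_integral_pushforward//.
by rewrite preimage_setT; apply: eq_integral => z _ /=; rewrite phiE.
Qed.

Section Majorant.
Variable H : borelC R d -> \bar R.
Hypothesis mH : measurable_fun setT H.
Hypothesis H0 : forall z, (0 <= H z)%E.

Lemma measurable_radial :
  measurable_fun setT (fun x : measurableTypeR R * borelC R d =>
    H ((x.1 : R)%:C *: (x.2 : 'rV[C]_d))).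
Proof.
apply: (measurableT_comp mH).
apply: (@measurable_scale_row _ _
  (fun x : measurableTypeR R * borelC R d => x.1) (cst 0) snd).
- exact: measurable_fst.
- exact: measurable_cst.
- exact: measurable_snd.
Qed.

Lemma measurable_circle_pt (r : R) (dd : measure_display)
    (T : measurableType dd) (f : T -> R) (h : T -> 'rV[C]_d) :
  measurable_fun setT f -> measurable_fun setT (h : T -> borelC R d) ->
  measurable_fun setT (fun x => H ((r%:C * circle_pt (f x)) *: h x)).
Proof.
move=> mf mh; apply: (measurableT_comp mH).
have -> : (fun x => (r%:C * circle_pt (f x)) *: h x : borelC R d) =
    (fun x => ((r * Num.sqrt (1 - f x ^+ 2)) +i* (r * f x)) *: h x).
  apply/funext => x; congr (_ *: _); rewrite /circle_pt.
  by apply/eqP; rewrite eq_complex /=; apply/andP; split; apply/eqP; ring.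
apply: measurable_scale_row => //; apply: measurable_funM => //.
apply: (measurableT_comp (f := @Num.sqrt R)).
  by apply: continuous_measurable_fun; exact: sqrt_continuous.
apply: measurable_funB => //.
by apply: (measurable_funM mf mf).
Qed.

(* Since [sigma] is invariant under [z |-> c z] for each fixed unimodular [c],
   one may average over any probability measure on the circle, here the image
   of Lebesgue measure on [0, 1] under [circle_pt]. *)
Lemma sigma_average (r : R) (k : R) : 0 <= k ->
  (forall z, unit_sphere z ->
    (\int[leb]_(t in `[0%R, 1%R]) H ((r%:C * circle_pt t) *: z) <= k%:E)%E) ->
  (\int[sigma]_z H (r%:C *: (z : 'rV[C]_d)) <= k%:E)%E.
Proof.
move=> k0 Hk.
(* The restriction to [[0, 1]] is put into the integrand, so that Tonelli applies on the whole
   product. *)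
pose G (x : measurableTypeR R * borelC R d) : \bar R :=
  ((fun t : R => H ((r%:C * circle_pt t) *: (x.2 : 'rV[C]_d)))
     \_ `[0, 1]%classic) x.1.
have G0 x : (0 <= G x)%E by rewrite /G; apply: erestrict_ge0.
have mG : measurable_fun setT G.
  have mD : measurable (`[0, 1]%classic `*` setT :
      set (measurableTypeR R * borelC R d)).
    by apply: measurableX => //; exact: measurable_itv.
  have -> : G = (fun x : measurableTypeR R * borelC R d =>
      H ((r%:C * circle_pt x.1) *: (x.2 : 'rV[C]_d))) \_
        (`[0, 1]%classic `*` setT).
    apply/funext => -[t z]; rewrite /G !patchE /=.
    by rewrite !mem_setE /= in_setX /= in_setT andbT mem_setE.
  apply/(measurable_restrictT _ mD); apply: measurable_funTS.
  apply: measurable_circle_pt; first exact: measurable_fst.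
  exact: measurable_snd.
have leb01 : leb (`[0, 1]%classic : set R) = 1%E.
  by rewrite lebesgue_measure_itv /= lte_fin ltr01 oppr0 adde0.
(* The left-hand side is first averaged as a constant over [[0, 1]], of measure 1, and for each [t]
   it is then rotated by [circle_pt t]. *)
have -> : (\int[sigma]_z H (r%:C *: (z : 'rV[C]_d)) =
           \int[leb]_t \int[sigma]_z G (t, z))%E.
  have mHr : measurable_fun setT (fun z : borelC R d =>
       H (r%:C *: (z : 'rV[C]_d))).
    pose psi (z : borelC R d) : borelC R d := (r +i* 0) *: (z : 'rV[C]_d).
    have mpsi : measurable_fun setT psi.
      by apply: measurable_scale_row => //; exact: measurable_id.
    exact: (measurableT_comp mH mpsi).
  transitivity (\int[leb]_(t in `[0%R, 1%R])
      (cst (\int[sigma]_z H (r%:C *: (z : 'rV[C]_d)))) t)%E.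
    rewrite [RHS]integral_cst//.
    by rewrite [X in (_ * X)%E](leb01 : leb _ = _) mule1.
  rewrite integral_mkcond; apply: eq_integral => t _.
  rewrite patchE /G /=; case: ifPn => tin.
    have t01 : 0 <= t <= 1 by move: tin; rewrite inE /= in_itv.
    rewrite (@integral_sigma_rotate (circle_pt t))//; last first.
      by rewrite normc_circle_pt.
    apply: eq_integral => z _; rewrite patchE tin scalerA.
    by [].
  by rewrite integral0_eq// => z _; rewrite patchE (negbTE tin).
rewrite (fubini_tonelli G mG G0).
have GE z : (\int[leb]_t G (t, z) =
   \int[leb]_(t in `[0%R, 1%R]) H ((r%:C * circle_pt t) *: (z : 'rV[C]_d)))%E.
  by rewrite [RHS]integral_mkcond.
under eq_integral do rewrite GE.
apply: (@le_trans _ _ (\int[sigma]_z (cst k%:E) z)%E); last first.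
  rewrite integral_cst//.
  by rewrite [X in (_ * X <= _)%E](probability_setT sigma : sigma _ = _) mule1.
apply: ae_ge0_le_integral => //.
- by move=> z _; apply: integral_ge0.
- have mFG := measurable_fun_fubini_tonelli_G (m1 := leb) G mG G0.
  by apply: eq_measurable_fun mFG => z _; rewrite /fubini_G GE.
(* The bound holds on the sphere, whose complement is [sigma]-null. *)
- have ms := measurable_unit_sphere.
  have sC : sigma (~` (@unit_sphere R d : set (borelC R d))) = 0%E.
    by rewrite probability_setC// sigma_inv.1 subee.
  exists (~` @unit_sphere R d); split; first exact: measurableC.
    exact: sC.
  by move=> z /= hz zs; apply: hz => _; exact: Hk.
Qed.

Variables (u : R -> R) (mu : {measure set (measurableTypeR R) -> \bar R}).
Hypothesis u_Linfty : Linfty01 u.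
Hypothesis mu_density : has_radial_density u mu.

(** On [[0, 1]] the density satisfies [|u r| 2 r <= 2 |M|] almost everywhere. *)
Lemma radial_density_bound : exists M : {nonneg R},
  forall A : set (measurableTypeR R), measurable A ->
    (mu A <= mscale M leb (A `&` `[0%R, 1%R]%classic))%E.
Proof.
case: u_Linfty => mu_ [M uM].
have M0 : 0 <= 2 * `|M| by rewrite mulr_ge0.
exists (NngNum M0) => A mA.
have mA' : measurable (A `&` `[0%R, 1%R]%classic).
  by apply: measurableI => //; exact: measurable_itv.
have mur : measurable_fun (A `&` `[0%R, 1%R]%classic)
    (fun r : R => (u r * (2 * r))%:E).
  apply/measurable_EFinP; apply: measurable_funM.
    by apply: measurable_funS mu_ => //; exact: measurable_itv.
  by apply: measurable_funM.
rewrite mu_density//; apply: le_trans (lee_abs _) _.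
apply: le_trans (le_abse_integral _ mA' mur) _.
rewrite /mscale /= -integral_cst//.
apply: ae_ge0_le_integral => //.
- apply/measurable_EFinP; apply: measurableT_comp => //.
  exact/measurable_EFinP.
- case: uM => N [mN N0 Nsub]; exists N; split => // r /= hr; apply: Nsub => ur.
  apply: hr => -[_ r01]; have /= := ur r01.
  move: r01; rewrite /= in_itv/= => /andP[r0 r1] urM.
  rewrite lee_fin normrM [`|2 * r|]ger0_norm; last by rewrite mulr_ge0.
  rewrite mulrCA ler_pM2l// (le_trans _ (ler_norm M))// (le_trans _ urM)//.
  by rewrite ler_piMr.
Qed.

Variable omega : {measure set (borelC R d) -> \bar R}.
Hypothesis omega_adm : is_admissible_radial sigma mu omega.

(** Integration in polar coordinates: domination of [mu] by a multiple of Lebesgue measure reduces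
    finiteness to the integral of [log_prim]. *)
Lemma radial_integral_lty (c : R) : 0 <= c ->
  (forall r, 0 <= r < 1 ->
    (\int[sigma]_z H (r%:C *: (z : 'rV[C]_d)) <=
     (c * log_prim ((1 - r) / 2))%:E)%E) ->
  (\int[omega]_z H z < +oo)%E.
Proof.
move=> c0 Hc; have [M muM] := radial_density_bound.
have m01 : measurable (`[0, 1]%classic : set (measurableTypeR R)).
  exact: measurable_itv.
have leb01 : leb (`[0, 1]%classic : set R) = 1%E.
  by rewrite lebesgue_measure_itv /= lte_fin ltr01 oppr0 adde0.
have mu_fin : fin_num_fun mu.
  move=> A mA; rewrite ge0_fin_numE//; apply: (le_lt_trans (muM A mA)).
  rewrite /mscale /=; apply: (@le_lt_trans _ _ (M%:num%:E * 1)%E).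
    rewrite lee_wpmul2l ?lee_fin// -leb01 le_measure ?inE//.
    exact: measurableI.
  by rewrite mule1 ltry.
have mu_sigma_fin : sigma_finite setT mu.
  by apply: fin_num_fun_sigma_finite; rewrite ?measure0.
(* The finiteness of [mu] is recorded in a sigma-finite structure [mu'] on the same measure, as
   Tonelli requires. *)
pose H1 := isSFinite.Build _ _ _ _ (sfinite_measure_sigma_finite mu_sigma_fin).
pose H2 := isSigmaFinite.Build _ _ _ _ mu_sigma_fin.
pose mu' := HB.pack_for (SigmaFiniteMeasure.type (measurableTypeR R) R)
  (measure_function.Measure.sort mu) H1 H2.
pose phi (x : measurableTypeR R * borelC R d) : borelC R d :=
  (x.1 : R)%:C *: (x.2 : 'rV[C]_d).
have mphi : measurable_fun setT phi.
  exact: (@measurable_scale_row _ _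
    (fun x : measurableTypeR R * borelC R d => x.1) (cst 0) snd
    measurable_fst (measurable_cst _) measurable_snd).
have -> : (\int[omega]_z H z =
           \int[pushforward (mu' \x sigma) phi]_z H z)%E.
  by apply: eq_measure_integral => A mA _; case: omega_adm => _ _ ->.
rewrite ge0_integral_pushforward// preimage_setT.
have mHphi := measurable_radial.
rewrite (fubini_tonelli1 (m1 := mu') (m2 := sigma) (H \o phi) mHphi
  (fun x => H0 _)).
set Phi := fubini_F _ _.
have mPhi : measurable_fun setT Phi.
  exact: (measurable_fun_fubini_tonelli_F (H \o phi) mHphi (fun x => H0 _)).
have Phi0 r : (0 <= Phi r)%E by apply: integral_ge0 => z _; exact: H0.
have -> : (\int[mu']_r Phi r = \int[mu]_(r in `[0%R, 1%R]) Phi r)%E.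
  rewrite (@ge0_negligible_integral _ _ _ mu setT (~` `[0%R, 1%R]%classic))//.
  - by rewrite setTD setCK.
  - exact: measurableC.
  - by case: omega_adm.
apply: (@le_lt_trans _ _ (\int[mscale M leb]_(r in `[0%R, 1%R]) Phi r)%E).
  apply: ge0_le_measure_integral => // A mA.
  apply: (le_trans (muM A mA)); rewrite /mscale /= lee_wpmul2l ?lee_fin//.
  by rewrite le_measure ?inE//; exact: measurableI.
rewrite ge0_integral_mscale//; last exact: measurable_funTS.
(* The bound on the spherical means is available for [r < 1]; the endpoint 1 is Lebesgue-null. *)
rewrite -integral_itv_bndo_bndc; last exact: measurable_funTS.
have mlp : measurable_fun (`[0%R, 1%R[%classic : set (measurableTypeR R))
    (fun r : R => log_prim ((1 - r) / 2)).
  exact: measurable_log_prim.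
have lp0 (r : R) : `[0%R, 1%R[%classic r ->
    (0 <= (log_prim ((1 - r) / 2))%:E)%E.
  by rewrite /= in_itv/= => r01; rewrite lee_fin log_prim_ge0//; lra.
apply: (@le_lt_trans _ _ (M%:num%:E * (c%:E * 1))%E); last first.
  by rewrite mule1 -EFinM ltry.
rewrite lee_wpmul2l ?lee_fin//.
apply: (@le_trans _ _ (\int[leb]_(r in `[0%R, 1%R[)
    (c%:E * (log_prim ((1 - r) / 2))%:E))%E).
  apply: ge0_le_integral => //.
  - exact: measurable_funTS.
  - by apply/measurable_EFinP; apply: measurable_funM.
rewrite ge0_integralZl_EFin//; last exact/measurable_EFinP.
by rewrite lee_wpmul2l ?lee_fin// integral_log_prim_le1.
Qed.

End Majorant.

End RadialIntegral.

(** * Measurability and integral bounds for the radial derivative *)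

Section MainBound.
Variables (R : realType) (d : nat).
Local Notation C := R[i].
Local Notation nc := (@Normc.normc R).
Local Notation leb := (@lebesgue_measure R).
Variables (p : mpoly.mpoly d C) (n : nat) (L : 'rV[C]_d -> C).
Hypothesis p_neq0 : forall z : 'rV[C]_d, unit_ball z -> cpoly_eval p z <> 0.
Hypothesis n_deg : (total_degree p <= n)%N.
Hypothesis L_log : is_analytic_log
  (fun z => 2 ^+ n * cpoly_eval p 0 / cpoly_eval p z) L.
Local Notation F := (fun z => principal_log (1 + L z)).

Lemma measurable_radial_deriv_Re :
  measurable_fun (@unit_ball R d : set (borelC R d))
    (fun z => complex.Re (radial_deriv F z) : R).
Proof.
apply: open_cvg_measurable_fun; first exact: open_unit_ball.
move=> z zb; apply: (@cvg_comp _ _ _ (radial_deriv F : 'rV[C]_d -> C)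
  (@complex.Re R) (nbhs z) (nbhs (radial_deriv F z))).
  exact: (cvg_radial_deriv_inner_log p_neq0 n_deg L_log).
exact: continuous_Re.
Qed.

Lemma measurable_radial_deriv_Im :
  measurable_fun (@unit_ball R d : set (borelC R d))
    (fun z => complex.Im (radial_deriv F z) : R).
Proof.
apply: open_cvg_measurable_fun; first exact: open_unit_ball.
move=> z zb; apply: (@cvg_comp _ _ _ (radial_deriv F : 'rV[C]_d -> C)
  (@complex.Im R) (nbhs z) (nbhs (radial_deriv F z))).
  exact: (cvg_radial_deriv_inner_log p_neq0 n_deg L_log).
exact: continuous_Im.
Qed.

(** Extended by 0 outside the ball, so that it is defined and measurable on all of [C^d]. *)
Definition sqnorm_radial (z : borelC R d) : \bar R :=
  ((fun z : borelC R d => (nc (radial_deriv F (z : 'rV[C]_d)) ^+ 2)%:E)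
     \_ (@unit_ball R d : set (borelC R d))) z.

Lemma sqnorm_radial_ge0 z : (0 <= sqnorm_radial z)%E.
Proof. by apply: erestrict_ge0 => x _; rewrite lee_fin sqr_ge0. Qed.

Lemma measurable_sqnorm_radial : measurable_fun setT sqnorm_radial.
Proof.
have mb : measurable (@unit_ball R d : set (borelC R d)).
  by apply: open_borelC; exact: open_unit_ball.
apply/(measurable_restrictT _ mb)/measurable_EFinP.
have -> : (fun z : borelC R d => nc (radial_deriv F (z : 'rV[C]_d)) ^+ 2) =
  (fun z : borelC R d => complex.Re (radial_deriv F (z : 'rV[C]_d)) ^+ 2 +
                         complex.Im (radial_deriv F (z : 'rV[C]_d)) ^+ 2).
  apply/funext => z; case: (radial_deriv F z) => a b /=.
  by rewrite sqr_sqrtr// addr_ge0 ?sqr_ge0.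
by apply: measurable_funD; apply: measurable_funX;
  [exact: measurable_radial_deriv_Re|exact: measurable_radial_deriv_Im].
Qed.

(** At most [n] kernels contribute [8 log_prim] each; with the factor [16 n r] and [r < 1] this
    gives [128 n ^ 2]. *)
Lemma ray_integral_bound (z : 'rV[C]_d) (r : R) : unit_sphere z ->
  0 <= r < 1 ->
  (\int[leb]_(t in `[0%R, 1%R]) sqnorm_radial ((r%:C * circle_pt t) *: z) <=
   ((128 * n%:R ^+ 2) * log_prim ((1 - r) / 2))%:E)%E.
Proof.
move=> zs r01; have [r0 r1] := andP r01.
have z1 : sqnormC z <= 1 by rewrite zs.
have [s [ss s01 hs]] := ray_bound p_neq0 n_deg L_log z1 r01.
(* The value 0 for [t0] outside [[0, 1]] makes measurability and nonnegativity hold for every index,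
   not only for those in [s]. *)
pose k t0 (t : R) := (if 0 <= t0 <= 1
  then r * log_kernel ((1 - r + r * `|t - t0|) / 2) else 0)%:E.
have m01 : measurable (`[0, 1]%classic : set (measurableTypeR R)).
  exact: measurable_itv.
have mk t0 :
    measurable_fun (`[0, 1]%classic : set (measurableTypeR R)) (k t0).
  rewrite /k; case: (boolP (0 <= t0 <= 1)) => [t001|_]; last first.
    exact: measurable_cst.
  apply/measurable_EFinP; apply: measurable_log_kernel_abs => //.
  by move=> t /=; rewrite !in_itv/=; lra.
have k0 t0 (t : R) : `[0, 1]%classic t -> (0 <= k t0 t)%E.
  rewrite /k; case: ifPn => // t001; rewrite /= in_itv/= => t01.
  have /(abs_arg_bounds r01)/andP[y0 y1] : t0 - 3 / 2 <= t <= t0 + 3 / 2 by lra.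
  by rewrite lee_fin mulr_ge0// log_kernel_ge0.
have lp0 : 0 <= log_prim ((1 - r) / 2) by rewrite log_prim_ge0//; lra.
have c0 : 0 <= 16 * n%:R * r by rewrite !mulr_ge0.
have sumk0 (t : R) : `[0, 1]%classic t -> (0 <= (\sum_(t0 <- s) k t0 t)%R)%E.
  by move=> t01; apply: sume_ge0 => t0 _; exact: k0.
have msumk : measurable_fun (`[0, 1]%classic : set (measurableTypeR R))
    (fun t => (\sum_(t0 <- s) k t0 t)%R).
  exact: emeasurable_sum.
have sumk : (\int[leb]_(t in `[0%R, 1%R]) (\sum_(t0 <- s) k t0 t)%R <=
    (n%:R * (8 * log_prim ((1 - r) / 2)))%:E)%E.
  rewrite ge0_integral_sum//.
  apply: (@le_trans _ _ (\sum_(t0 <- s) (8 * log_prim ((1 - r) / 2))%:E)%E).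
    apply: lee_sum => t0 _; rewrite /k; case: (boolP (0 <= t0 <= 1)) => t001.
      exact: integral_log_kernel_abs.
    by rewrite integral0 lee_fin mulr_ge0.
  rewrite sumEFin lee_fin big_const_seq count_predT iter_addr_0.
  by rewrite -[leLHS]mulr_natl ler_wpM2r ?mulr_ge0// ler_nat.
apply: (@le_trans _ _ (\int[leb]_(t in `[0%R, 1%R])
    ((16 * n%:R * r)%:E * (\sum_(t0 <- s) k t0 t)%R))%E).
  apply: ge0_le_integral => //.
  - by move=> t _; exact: sqnorm_radial_ge0.
  - apply: measurable_funTS.
    exact: (measurable_circle_pt measurable_sqnorm_radial).
  - exact: measurable_funeM.
  - move=> t t01.
    rewrite /sqnorm_radial patchE; case: ifPn => _; last first.
      by rewrite mule_ge0// ?sumk0// lee_fin.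
    have -> : (\sum_(t0 <- s) k t0 t)%R =
        (\sum_(t0 <- s) r * log_kernel ((1 - r + r * `|t - t0|) / 2))%:E.
      rewrite -sumEFin; apply: eq_big_seq => t0 /s01 t001.
      by rewrite /k t001.
    rewrite -EFinM lee_fin; apply: hs.
    by move: t01; rewrite /= in_itv.
rewrite ge0_integralZl_EFin//.
apply: (le_trans (lee_wpmul2l _ sumk)); first by rewrite lee_fin.
rewrite -EFinM lee_fin.
have -> : 16 * n%:R * r * (n%:R * (8 * log_prim ((1 - r) / 2))) =
    r * (128 * n%:R ^+ 2 * log_prim ((1 - r) / 2)) by ring.
by rewrite ler_piMl ?(ltW r1)// !mulr_ge0// sqr_ge0.
Qed.

End MainBound.

Theorem theorem6p4 (R : realType) (d : nat) (d_gt0 : (0 < d)%N)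
  (sigma : probability (borelC R d) R)
  (sigma_inv : is_normalized_rotation_invariant sigma)
  (u : R -> R) (u_Linfty : Linfty01 u)
  (mu : {measure set (measurableTypeR R) -> \bar R})
  (mu_density : has_radial_density u mu)
  (omega : {measure set (borelC R d) -> \bar R})
  (omega_adm : is_admissible_radial sigma mu omega)
  (p : mpoly.mpoly d R[i])
  (p_neq0 : forall z : 'rV[R[i]]_d, unit_ball z -> cpoly_eval p z <> 0)
  (n : nat) (n_deg : (total_degree p <= n)%N)
  (L : 'rV[R[i]]_d -> R[i])
  (L_log : is_analytic_log
     (fun z => 2 ^+ n * cpoly_eval p 0 / cpoly_eval p z) L) :
  B1 omega (fun z => principal_log (1 + L z)).
Proof.
split; first by move=> z; exact: (differentiable_inner_log p_neq0 n_deg L_log).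
split; [exact: (measurable_radial_deriv_Re p_neq0 n_deg L_log)|
        exact: (measurable_radial_deriv_Im p_neq0 n_deg L_log)|].
(* The integral over the ball becomes that of [sqnorm_radial] over the whole space. *)
rewrite integral_mkcond.
have c0 : 0 <= 128 * n%:R ^+ 2 :> R by rewrite mulr_ge0// sqr_ge0.
have mH := measurable_sqnorm_radial p_neq0 n_deg L_log.
have H0 := @sqnorm_radial_ge0 R d L.
apply: (radial_integral_lty mH H0 u_Linfty mu_density omega_adm c0) => r r01.
apply: (sigma_average sigma_inv mH H0) => [|z zs].
  by rewrite mulr_ge0// log_prim_ge0//; lra.
exact: (ray_integral_bound p_neq0 n_deg L_log zs r01).
Qed.
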